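(* Let $d\ge4$ be an even integer and let $\mathcal{L}_1,\mathcal{L}_2:M_d(\mathbb{C})\to M_d(\mathbb{C})$ be two Hermitian-preserving linear maps. (1) If both $\mathcal{L}_1$ and $\mathcal{L}_2$ are PPT maps, each of which is either $(S,S)$-covariant or $(S,\overline S)$-covariant, then the composition $\mathcal{L}_1\circ\mathcal{L}_2$ is entanglement breaking. (2) If $\mathcal{L}_1$ is a positive map that is either $(S,S)$- or $(S,\overline S)$-covariant, and $\mathcal{L}_2$ is a PPT map that is either $(S,S)$- or $(S,\overline S)$-covariant, then both compositions $\mathcal{L}_1\circ\mathcal{L}_2$ and $\mathcal{L}_2\circ\mathcal{L}_1$ are decomposable.
   Context: $\Omega_d=\begin{pmatrix}0&I_{d/2}\\-I_{d/2}&0\end{pmatrix}$, $Sp(d)=\{S\in U(d):S^\top\Omega_dS=\Omega_d\}$. A linear map $\mathcal{L}$ on $M_d(\mathbb{C})$ is $(S,S)$-covariant if $\mathcal{L}(SZS^* )=S\mathcal{L}(Z)S^*$, and $(S,\overline S)$-covariant if $\mathcal{L}(SZS^* )=\overline S\mathcal{L}(Z)\overline S^*$, for all $S\in Sp(d)$ and $Z\in M_d(\mathbb{C})$ ($\overline S$ = entrywise complex conjugate). The Choi matrix of $\mathcal{L}$ is $C_{\mathcal{L}}=\frac1d\sum_{i,j}|i\rangle\langle j|\otimes\mathcal{L}(|i\rangle\langle j|)$. $\mathcal{L}$ is positive if it maps positive semidefinite matrices to positive semidefinite matrices; completely positive (CP) if $C_{\mathcal{L}}\ge0$; completely copositive (co-CP)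 if $\top\circ\mathcal{L}$ is CP, where $\top(Z)=Z^\top$; decomposable if it is the sum of a CP and a co-CP map; PPT if it is CP and its Choi matrix has positive semidefinite partial transpose $(\mathrm{id}\otimes\top)(C_{\mathcal{L}})\ge0$; entanglement breaking if its Choi matrix is separable, i.e. a finite sum of matrices $X\otimes Y$ with $X,Y\ge0$. *)

(* Defs.v *)
(* The complex field is R[i] for an arbitrary R : realType. *)
From mathcomp Require Export all_boot all_order all_algebra.
From mathcomp Require Export reals.
From mathcomp.real_closed Require Export complex mxtens.

Set Implicit Arguments.
Unset Strict Implicit.
Unset Printing Implicit Defensive.

Import Order.TTheory GRing.Theory Num.Theory.
Local Open Scope ring_scope.
Local Open Scope sesquilinear_scope.

Definition conjmat (C : numClosedFieldType) m n (A : 'M[C]_(m, n)) :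
  'M[C]_(m, n) := map_mx Num.conj A.

(* In the partial order of a numClosedFieldType, 0 <= z entails that z is
   real. *)
Definition psdmx (C : numClosedFieldType) n (A : 'M[C]_n) : Prop :=
  A \is hermsymmx /\ forall v : 'cV[C]_n, 0 <= (v^t* *m A *m v) 0 0.

(* Entrywise, so that no cast from d./2 + d./2 to d is needed; see Omega_block.
   Meaningful for even d only. *)
Definition Omega (C : pzRingType) d : 'M[C]_d :=
  \matrix_(i, j) if j == (i + d./2)%N :> nat then 1
                 else if i == (j + d./2)%N :> nat then -1 else 0.

Lemma Omega_block (C : pzRingType) n :
  Omega C (n + n) = block_mx 0 1%:M (- 1%:M) 0.
Proof.
have ltF (i j : 'I_n) : (i == j + n :> nat)%N = false.
  by rewrite ltn_eqF // (leq_trans (ltn_ord i)) ?leq_addl.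
have ltF' (i j : 'I_n) : (i == n + j + n :> nat)%N = false.
  by rewrite ltn_eqF // (leq_trans (ltn_ord i)) ?leq_addl.
have halfE : (n + n)./2 = n by rewrite addnn doubleK.
apply/matrixP => i j; rewrite mxE halfE.
case: (split_ordP i) => i' ->; case: (split_ordP j) => j' ->;
  rewrite ?(block_mxEul, block_mxEur, block_mxEdl, block_mxEdr) !mxE /=.
- by rewrite !ltF.
- by rewrite ltF' [(n + j')%N]addnC eqn_add2r (inj_eq val_inj) eq_sym; case: eqP.
- rewrite ltF' [(n + i')%N]addnC eqn_add2r (inj_eq val_inj).
  by case: eqP; rewrite ?oppr0.
- by rewrite -!addnA !eqn_add2l !ltF.
Qed.

Definition Sp (C : numClosedFieldType) d (S : 'M[C]_d) : Prop :=
  S \is unitarymx /\ S^T *m Omega C d *m S = Omega C d.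

(* Transposition of the second tensor factor, (id (x) T)(X). *)
Definition ptrans (C : pzRingType) m n (X : 'M[C]_(m * n)) : 'M[C]_(m * n) :=
  \matrix_(k, l) X (mxtens_index ((mxtens_unindex k).1, (mxtens_unindex l).2))
                   (mxtens_index ((mxtens_unindex l).1, (mxtens_unindex k).2)).

Lemma ptrans_tens (C : pzRingType) m n (A : 'M[C]_m) (B : 'M[C]_n) :
  ptrans (A *t B) = A *t B^T.
Proof. by apply/matrixP => k l; rewrite !mxE !mxtens_indexK. Qed.

Definition separable (C : numClosedFieldType) m n (M : 'M[C]_(m * n)) : Prop :=
  exists (r : nat) (X : 'I_r -> 'M[C]_m) (Y : 'I_r -> 'M[C]_n),
    (forall k, psdmx (X k) /\ psdmx (Y k)) /\ M = \sum_(k < r) X k *t Y k.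

Section Maps.
Variables (C : numClosedFieldType) (d : nat).
Local Notation linmap := {linear 'M[C]_d -> 'M[C]_d}.
Implicit Type L : linmap.

Definition choi L : 'M[C]_(d * d) :=
  d%:R^-1 *: \sum_(i < d) \sum_(j < d) delta_mx i j *t L (delta_mx i j).

Definition herm_preserving L : Prop :=
  forall Z, Z \is hermsymmx -> L Z \is hermsymmx.

Definition covariantSS L : Prop :=
  forall S Z, Sp S -> L (S *m Z *m S^t*) = S *m L Z *m S^t*.

Definition covariantSSbar L : Prop :=
  forall S Z, Sp S ->
    L (S *m Z *m S^t*) = conjmat S *m L Z *m (conjmat S)^t*.

Definition positive_map L : Prop := forall Z, psdmx Z -> psdmx (L Z).

Definition CP L : Prop := psdmx (choi L).

Definition coCP L : Prop := CP (trmx \o L).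

Definition decomposable L : Prop :=
  exists L1 L2 : linmap, [/\ CP L1, coCP L2 & forall Z, L Z = L1 Z + L2 Z].

Definition PPT L : Prop := CP L /\ psdmx (ptrans (choi L)).

Definition entanglement_breaking L : Prop := separable (choi L).

End Maps.

(* Main.v *)
(* Write J for Omega and sigma(Z) = J Z^T J^T.  Testing covariance on symplectic
   transvections shows that an (S, S)-covariant map is Z |-> a tr(Z) 1 + b Z +
   c sigma(Z); an (S, conj S)-covariant map is such a map followed by conjugation by
   J, which affects none of the notions involved.  Complete positivity forces
   a + c, a - c, a + b d - c >= 0, co-CP exchanges b and c, and positivity forces
   a, a + b, a + c >= 0.  The maps form a commutative algebra under composition.
   For (1), a >= b + c together with a + b d - c, a - b + c d >= 0 makes the map
   entanglement breaking: it is then a positive map applied after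
   Z |-> tr(Z) 1 + Z, which is a finite measure-and-prepare map built from vectors
   of fourth roots of unity.  These inequalities follow from b, c >= -a / (d - 1)
   for the two PPT maps.  For (2), the positive map is a nonnegative combination of
   tr(Z) 1 - Z - sigma(Z), Z and sigma(Z), and each composes with a PPT map to a
   decomposable one. *)
From HB Require Import structures.
Require Import Defs.
From mathcomp Require Import zify ring lra.

Set Implicit Arguments.
Unset Strict Implicit.
Unset Printing Implicit Defensive.

Import Order.TTheory GRing.Theory Num.Theory.
Local Open Scope ring_scope.
Local Open Scope sesquilinear_scope.

(** * Inner products, rank-one matrices and positive semidefiniteness *)

Section Adjoint.
Variable C : numClosedFieldType.

Lemma adjmxM m n p (A : 'M[C]_(m, n)) (B : 'M[C]_(n, p)) :
  (A *m B)^t* = B^t* *m A^t*.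
Proof. by rewrite trmx_mul map_mxM. Qed.

Lemma adjmxE m n (A : 'M[C]_(m, n)) i j : (A^t*) i j = (A j i)^*.
Proof. by rewrite !mxE. Qed.

Lemma adjmxK m n (A : 'M[C]_(m, n)) : (A^t*)^t* = A.
Proof. by apply/matrixP => i j; rewrite !mxE conjCK. Qed.

Lemma adjmxD m n (A B : 'M[C]_(m, n)) : (A + B)^t* = A^t* + B^t*.
Proof. by rewrite linearD /= map_mxD. Qed.

Lemma adjmxZ m n a (A : 'M[C]_(m, n)) : (a *: A)^t* = a^* *: A^t*.
Proof. by rewrite linearZ /= map_mxZ. Qed.

Lemma adjmx_conj m n (A : 'M[C]_(m, n)) : (conjmat A)^t* = A^T.
Proof. by apply/matrixP => i j; rewrite !mxE conjCK. Qed.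

Definition dot n (u v : 'cV[C]_n) : C := (u^t* *m v) 0 0.

Lemma dotE n (u v : 'cV[C]_n) : dot u v = \sum_i (u i 0)^* * v i 0.
Proof. by rewrite /dot mxE; apply: eq_bigr => i _; rewrite !mxE. Qed.

Lemma adj_mul_col n (u v : 'cV[C]_n) : u^t* *m v = (dot u v)%:M.
Proof. by rewrite [LHS]mx11_scalar. Qed.

Lemma dot_ge0 n (u : 'cV[C]_n) : 0 <= dot u u.
Proof. by rewrite dotE sumr_ge0 // => i _; rewrite mulrC mul_conjC_ge0. Qed.

Lemma dot_eq0 n (u : 'cV[C]_n) : (dot u u == 0) = (u == 0).
Proof.
apply/eqP/eqP => [|->]; last by rewrite dotE big1 // => i _; rewrite mxE mulr0.
have pos (i : 'I_n) : true -> 0 <= (u i 0)^* * u i 0.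
  by move=> _; rewrite mulrC mul_conjC_ge0.
rewrite dotE => /(psumr_eq0P pos) u0.
apply/matrixP => i j; rewrite (ord1 j) mxE; apply/eqP.
by have /eqP := u0 i isT; rewrite mulf_eq0 conjC_eq0 orbb.
Qed.

Lemma dotC n (u v : 'cV[C]_n) : dot u v = (dot v u)^*.
Proof.
by rewrite !dotE rmorph_sum; apply: eq_bigr => i _; rewrite rmorphM /= conjCK mulrC.
Qed.

Lemma dotDr n (u v w : 'cV[C]_n) : dot u (v + w) = dot u v + dot u w.
Proof. by rewrite /dot mulmxDr mxE. Qed.

Lemma dotZr n a (u v : 'cV[C]_n) : dot u (a *: v) = a * dot u v.
Proof. by rewrite /dot -scalemxAr mxE. Qed.

Lemma dotDl n (u v w : 'cV[C]_n) : dot (u + v) w = dot u w + dot v w.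
Proof. by rewrite /dot adjmxD mulmxDl mxE. Qed.

Lemma dotZl n a (u v : 'cV[C]_n) : dot (a *: u) v = a^* * dot u v.
Proof. by rewrite /dot adjmxZ -scalemxAl mxE. Qed.

Lemma outer_mul n (u v w : 'cV[C]_n) : (u *m v^t*) *m w = dot v w *: u.
Proof. by rewrite -mulmxA adj_mul_col mul_mx_scalar. Qed.

Lemma outer_mul_outer n (u v w t : 'cV[C]_n) :
  (u *m v^t*) *m (w *m t^t*) = dot v w *: (u *m t^t*).
Proof. by rewrite mulmxA outer_mul scalemxAl. Qed.

Lemma adjmx_outer n (u v : 'cV[C]_n) : (u *m v^t*)^t* = v *m u^t*.
Proof. by rewrite adjmxM adjmxK. Qed.

Definition basis n (i : 'I_n) : 'cV[C]_n := delta_mx i 0.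

Lemma dot_basisl n (i : 'I_n) v : dot (basis i) v = v i 0.
Proof.
rewrite dotE (bigD1 i) //= big1 => [|k /negPf ki]; rewrite !mxE ?eqxx ?ki.
  by rewrite conjC1 mul1r addr0.
by rewrite conjC0 mul0r.
Qed.

Lemma dot_basis n (i j : 'I_n) : dot (basis i) (basis j) = (i == j)%:R.
Proof. by rewrite dot_basisl mxE andbT. Qed.

Lemma outer_basis n (i j : 'I_n) : basis i *m (basis j)^t* = delta_mx i j.
Proof.
apply/matrixP => k l; rewrite !mxE big_ord1 !mxE andbT andbT.
by rewrite conjC_nat -natrM mulnb.
Qed.

(** Nonnegativity alone forces hermitian symmetry: the form is real at [basis i + z *: basis j], and
    polarizing with z = 1 and z = 'i recovers A i j as the conjugate of A j i. *)
Lemma psdmxP n (A : 'M[C]_n) :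
  (forall v, 0 <= dot v (A *m v)) -> psdmx A.
Proof.
move=> pA; split; last by move=> v; have := pA v; rewrite /dot mulmxA.
have entry i j : dot (basis i) (A *m basis j) = A i j.
  by rewrite dot_basisl mxE (bigD1 j) //= big1 => [|k /negPf kj];
    rewrite !mxE ?eqxx ?kj ?mulr1 ?addr0 ?mulr0.
have real v : (dot v (A *m v))^* = dot v (A *m v).
  by apply/CrealP/ger0_real.
have polar i j z : (z * A i j + z^* * A j i)^* = z * A i j + z^* * A j i.
  have := real (basis i + z *: basis j).
  rewrite mulmxDr -scalemxAr !dotDl !dotDr !dotZl !dotZr !entry !rmorphD /=.
  have := real (basis i); rewrite entry => Aii.
  have := real (basis j); rewrite entry => Ajj.
  rewrite !rmorphM /= !conjCK Aii Ajj.
  move/(congr1 (fun t => t - (A i i + z^* * (z * A j j)))) => H.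
  transitivity ((A i i + z^* * (A i j)^* + (z * (A j i)^* + z * (z^* * A j j)))
     - (A i i + z^* * (z * A j j))); first by ring.
  by rewrite H; ring.
apply/is_hermitianmxP/matrixP => i j; rewrite expr0 scale1r !mxE.
have := polar i j 1; have := polar i j 'i.
rewrite conjC1 conjCi !mul1r !rmorphD !rmorphM /= rmorphN /= conjCi => H1 H2.
have H3 : 'i * ((A i j)^* * -1 + (A j i)^*) = 'i * (A i j - A j i).
  by rewrite mulrDr; transitivity (- 'i * (A i j)^* + - - 'i * (A j i)^*);
   [ring | rewrite H1; ring].
have /(mulfI (neq0Ci _)) H4 := H3.
have : 2 * A i j = 2 * (A j i)^*.
  transitivity ((A i j + A j i) + (A i j - A j i)); first by ring.
  by rewrite -H2 -H4; ring.
by move/mulfI; apply; rewrite pnatr_eq0.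
Qed.

Lemma psdmx_dot n (A : 'M[C]_n) v : psdmx A -> 0 <= dot v (A *m v).
Proof. by case=> _ /(_ v); rewrite /dot mulmxA. Qed.

End Adjoint.

(** * The matrix J of the symplectic form *)

Section Omega.
Variables (C : numClosedFieldType) (d : nat).
Hypotheses (d_gt0 : (0 < d)%N) (d_even : ~~ odd d).
Local Notation J := (Omega C d).

Lemma tr_Omega : J^T = - J.
Proof.
apply/matrixP => i j; rewrite !mxE; have := ltn_ord i.
case: (eqVneq (i : nat) (j + d./2)%N) => [ij|_] lt_id; last first.
  by case: eqP => _; rewrite ?opprK ?oppr0.
by case: eqP => [ji|_]; [have : False by lia | rewrite opprK].
Qed.

(** J is a signed permutation without fixed points; this form keeps the two halves of the index
    range out of later proofs. *)
Lemma Omega_col (i : 'I_d) : exists (j : 'I_d) (s : C),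
  [/\ j != i, s = 1 \/ s = -1 & forall k, J k i = s *+ (k == j)].
Proof.
have [id|di] := ltnP i (d./2).
  have jd : (i + d./2 < d)%N by lia.
  exists (Ordinal jd), (-1); split; [by rewrite -val_eqE /=; apply/eqP; lia | by right |].
  move=> k; rewrite !mxE -val_eqE /=.
  by case: eqP => [ik|_]; case: eqP => [ki|_] //; have : False by lia.
have lt_id := ltn_ord i; have jd : (i - d./2 < d)%N by lia.
exists (Ordinal jd), 1; split; [by rewrite -val_eqE /=; apply/eqP; lia | by left |].
move=> k; have lt_kd := ltn_ord k; rewrite !mxE -val_eqE /=.
case: eqP => [ik|ik]; case: eqP => [ki|ki] //; try by have : False by lia.
by case: eqP => // ki'; have : False by lia.
Qed.

Lemma conj_Omega : conjmat J = J.
Proof.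
apply/matrixP => i j; rewrite !mxE.
by case: eqP => _; last case: eqP => _; rewrite ?rmorphN ?rmorph1 ?rmorph0. 
Qed.

Lemma adj_Omega : J^t* = - J.
Proof. by rewrite tr_Omega map_mxN; congr (- _); exact: conj_Omega. Qed.

Lemma Omega_skew i j : J i j = - J j i.
Proof. by rewrite -[in LHS](trmxK J) tr_Omega linearN !mxE. Qed.

Lemma Omega_sqr : J *m J = - 1%:M.
Proof.
apply/matrixP => i k; rewrite !mxE.
have [j [s [ji s1 Ji]]] := Omega_col i.
have s_n0 : s != 0 by case: s1 => ->; rewrite ?oppr_eq0 oner_eq0.
have ss : s * s = 1 by case: s1 => ->; rewrite ?mulrNN mulr1.
rewrite (bigD1 j) //= big1 => [|m mj]; last first.
  by rewrite Omega_skew Ji (negPf mj) mulr0n oppr0 mul0r.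
have [j' [t [_ _ Jj]]] := Omega_col j.
have jE : j' = i.
  apply/eqP; apply: contraNT s_n0 => ij.
  have /eqP := Jj i; rewrite Omega_skew Ji eqxx mulr1n [i == _]eq_sym (negPf ij).
  by rewrite mulr0n oppr_eq0.
have tE : t = - s by have := Jj i; rewrite Omega_skew Ji eqxx jE eqxx.
rewrite [J i j]Omega_skew Ji eqxx mulr1n [J j k]Omega_skew Jj jE tE addr0 eq_sym.
by case: eqP => _; rewrite ?mulr1n ?mulr0n ?oppr0 ?mulr0 // opprK mulNr ss.
Qed.

End Omega.

(** * Symplectic transvections *)

Section Symplectic.
Variables (C : numClosedFieldType) (d : nat).
Hypotheses (d_gt0 : (0 < d)%N) (d_even : ~~ odd d).
Local Notation J := (Omega C d).

Let trJ : J^T = - J := tr_Omega C d_gt0 d_even.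
Let adjJ : J^t* = - J := adj_Omega C d_gt0 d_even.
Let JJ : J *m J = - 1%:M := Omega_sqr C d_gt0 d_even.

(** The antiunitary quaternionic structure, of square -1; [Sp] consists of the unitaries commuting
    with it. *)
Definition partner (x : 'cV[C]_d) : 'cV[C]_d := J *m conjmat x.

Definition sigma (Z : 'M[C]_d) : 'M[C]_d := J *m Z^T *m J^T.

Lemma dot_partner_partner x y : dot (partner x) (partner y) = dot y x.
Proof.
rewrite /dot /partner adjmxM adjmx_conj adjJ mulmxN mulNmx mulmxA.
rewrite -(mulmxA _ J J) JJ mulmxN mulNmx opprK mulmx1.
by rewrite !mxE; apply: eq_bigr => i _; rewrite !mxE mulrC.
Qed.

Lemma dot_partnerl x y : dot (partner x) y = - (x^T *m J *m y) 0 0.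
Proof. by rewrite /dot /partner adjmxM adjmx_conj adjJ mulmxN mulNmx mxE. Qed.

Lemma bilin_Omega_skew (x y : 'cV[C]_d) :
  (x^T *m J *m y) 0 0 = - (y^T *m J *m x) 0 0.
Proof.
rewrite -[in LHS](trmxK (x^T *m J *m y)) mxE !trmx_mul trmxK trJ.
by rewrite mulNmx mulmxN mxE mulmxA.
Qed.

Lemma bilin_Omega_alt (x : 'cV[C]_d) : (x^T *m J *m x) 0 0 = 0.
Proof.
have /eqP := bilin_Omega_skew x x.
by rewrite -subr_eq0 opprK -mulr2n mulrn_eq0 /= => /eqP.
Qed.

Lemma dot_partner x : dot (partner x) x = 0.
Proof. by rewrite dot_partnerl bilin_Omega_alt oppr0. Qed.

Lemma dot_partner' x : dot x (partner x) = 0.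
Proof. by rewrite dotC dot_partner conjC0. Qed.

Lemma partner_skew x y : dot (partner x) y = - dot (partner y) x.
Proof. by rewrite !dot_partnerl bilin_Omega_skew. Qed.

Lemma sigma_outer x y : sigma (x *m y^t*) = partner y *m (partner x)^t*.
Proof.
rewrite /sigma /partner adjmxM adjmx_conj adjJ -trJ trmx_mul !mulmxA.
by congr (_ *m _ *m _ *m _); apply/matrixP => i j; rewrite !mxE.
Qed.

Lemma conj_partner x : conjmat (partner x) = J *m x.
Proof.
rewrite /partner {1}/conjmat map_mxM; congr (_ *m _); first exact: conj_Omega.
by apply/matrixP => i j; rewrite /conjmat !mxE; exact: conjCK.
Qed.

Lemma conj_outer (x y : 'cV[C]_d) : conjmat (x *m y^t*) = conjmat x *m y^T.
Proof.
rewrite {1}/conjmat map_mxM; congr (_ *m _).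
by apply/matrixP => i j; rewrite !mxE; exact: conjCK.
Qed.

Lemma unitary_adjmul (S : 'M[C]_d) : S \is unitarymx -> S^t* *m S = 1%:M.
Proof. by move/unitarymxP/mulmx1C. Qed.

Lemma unitary_Sp (S : 'M[C]_d) :
  S \is unitarymx -> J *m S = conjmat S *m J -> Sp S.
Proof.
move=> uS JS; split=> //.
rewrite -mulmxA JS mulmxA.
have -> : S^T *m conjmat S = conjmat (S^t* *m S).
  apply/matrixP => i j; rewrite !mxE rmorph_sum; apply: eq_bigr => k _.
  by rewrite !mxE rmorphM /= conjCK.
by rewrite unitary_adjmul // /conjmat map_mx1 mul1mx.
Qed.

(* The "quaternionic" transvection: x is multiplied by z and its partner by z^*. *)
Definition sref (x : 'cV[C]_d) (z : C) : 'M[C]_d :=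
  1%:M + ((z - 1) / dot x x) *: (x *m x^t*)
       + ((z^* - 1) / dot x x) *: (partner x *m (partner x)^t*).

Lemma conj_dot_self n (x : 'cV[C]_n) : (dot x x)^* = dot x x.
Proof. by rewrite -dotC. Qed.

(** Unitarity holds because x and its partner are orthogonal of equal norm. Moving J across
    exchanges the two rank-one terms up to conjugation, and their coefficients are conjugate to each
    other. *)
Lemma Sp_sref x z : x != 0 -> z * z^* = 1 -> Sp (sref x z).
Proof.
rewrite -dot_eq0 => N0 zz; apply: unitary_Sp.
  apply/unitarymxP; rewrite /sref !adjmxD !adjmxZ !adjmx_outer.
  rewrite trmx1 map_mx1 !rmorphM /= !rmorphB /= conjC1 conjCK fmorphV /= conj_dot_self.
  rewrite !mulmxDr !mulmxDl !mulmx1 !mul1mx -!scalemxAr -!scalemxAl !scalerA.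
  rewrite !outer_mul_outer !dot_partner_partner dot_partner dot_partner'.
  rewrite !scale0r !scaler0 !scalerA.
  move: (x *m x^t*) (partner x *m _) => P Q.
  move: (dot x x) N0 => N N0.
  apply/matrixP => i j; rewrite !mxE.
  (* With z^* written as an inverse, the goal is a rational identity. *)
  have -> : z^* = z^-1 by apply: (mulfI (x := z)); rewrite ?zz ?divff //;
    apply: contra_eq_neq zz => ->; rewrite mul0r eq_sym oner_eq0.
  field; rewrite N0 /=.
  by apply: contra_eq_neq zz => ->; rewrite mul0r eq_sym oner_eq0.
have JP : J *m (x *m x^t*) = conjmat (partner x *m (partner x)^t*) *m J.
  rewrite conj_outer conj_partner /partner trmx_mul trJ !(mulmxN, mulNmx) -!mulmxA.
  rewrite JJ !(mulmxN, mulNmx) mulmx1 opprK; do 2 congr (_ *m _).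
  by apply/matrixP => i j; rewrite !mxE.
have JQ : J *m (partner x *m (partner x)^t*) = conjmat (x *m x^t*) *m J.
  rewrite conj_outer /partner adjmxM adjmx_conj adjJ mulmxN !mulmxA JJ.
  by rewrite !mulNmx mul1mx mulmxN opprK mulmxA.
rewrite /sref !mulmxDr -!scalemxAr mulmx1 JP JQ.
rewrite /conjmat !map_mxD !map_mxZ map_mx1 !mulmxDl mul1mx -!scalemxAl.
rewrite !rmorphM /= !rmorphB /= conjC1 conjCK fmorphV /= conj_dot_self.
by rewrite -!addrA; congr (_ + _); rewrite addrC.
Qed.

Lemma sref_mul x z y : sref x z *m y = y + ((z - 1) / dot x x * dot x y) *: x
  + ((z^* - 1) / dot x x * dot (partner x) y) *: partner x.
Proof. by rewrite /sref !mulmxDl mul1mx -!scalemxAl !outer_mul !scalerA. Qed.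

Lemma Sp_comm (L : {linear 'M[C]_d -> 'M[C]_d}) S Z :
  covariantSS L -> Sp S -> S *m Z *m S^t* = Z -> S *m L Z = L Z *m S.
Proof.
move=> cL sS SZ; have [uS _] := sS.
by rewrite -[in RHS]SZ cL // -!mulmxA unitary_adjmul // mulmx1.
Qed.

(** Every transvection along y scales x by a phase, so it fixes x x^* under conjugation and commutes
    with its image. Two values of z suffice to separate y y^* from the partner term. *)
Lemma covariant_comm (L : {linear 'M[C]_d -> 'M[C]_d}) x y :
  covariantSS L -> y != 0 -> dot (partner y) x = 0 ->
  y = x \/ dot y x = 0 ->
  (y *m y^t*) *m L (x *m x^t*) = L (x *m x^t*) *m (y *m y^t*).
Proof.
move=> cL y0 pyx yx.
have key z : z * z^* = 1 ->
   sref y z *m L (x *m x^t*) = L (x *m x^t*) *m sref y z.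
  move=> zz; apply: Sp_comm => //; first exact: Sp_sref.
  rewrite -mulmxA -mulmxA -adjmxM mulmxA sref_mul pyx mulr0 scale0r addr0.
  case: yx => [yE|->].
    rewrite -yE divfK ?dot_eq0 //.
    rewrite scalerBl scale1r addrC subrK adjmxZ -scalemxAl -scalemxAr scalerA zz.
    by rewrite scale1r.
  by rewrite mulr0 scale0r addr0.
have K1 := key (-1); have Ki := key 'i.
move: (L _) K1 Ki => M; rewrite /sref  ?(rmorphN, rmorph1) conjCi.
rewrite !mulmxDl !mulmxDr !mul1mx !mulmx1 -!scalemxAl -!scalemxAr.
rewrite -dot_eq0 in y0; move: (dot y y) y0 => N N0.
move: (y *m y^t*) (partner y *m _) => P Q.
rewrite mulrNN mulr1 mulrN -expr2 sqrCi opprK => /(_ erefl) K1 /(_ erefl) K2.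
apply/matrixP => i j; move/matrixP/(_ i j): K1; move/matrixP/(_ i j): K2.
rewrite ![((_ + _ : 'M_d) i j)]mxE ![((_ *: _ : 'M_d) i j)]mxE.
move: (M i j) ((P *m M) i j) ((Q *m M) i j) ((M *m P) i j) ((M *m Q) i j).
move=> m p q p' q' K2 K1; apply/eqP; rewrite -subr_eq0.
(* Subtracting ('i + 1) / 2 times the relation for z = -1 from the one for z = 'i cancels the
   partner term and leaves the coefficient 2 'i / N on y y^*. *)
apply/eqP; transitivity (N / (2 * 'i) *
  ((m + ('i - 1) / N * p + (- 'i - 1) / N * q)
    - (m + ('i - 1) / N * p' + (- 'i - 1) / N * q')
   - ('i + 1) / 2 * ((m + (-1 - 1) / N * p + (-1 - 1) / N * q)
       - (m + (-1 - 1) / N * p' + (-1 - 1) / N * q')))).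
  by field; rewrite N0 neq0Ci.
by rewrite K1 K2 !subrr mulr0 subr0 mulr0.
Qed.

End Symplectic.

Lemma ord_exists_neq2 d (i j : 'I_d) : (2 < d)%N -> exists k : 'I_d, k != i /\ k != j.
Proof.
move=> d2; have : (0 < #|~: [set i; j]|)%N.
  have := cardsC [set i; j]; rewrite card_ord cards2; lia.
by case/card_gt0P => k; rewrite !inE negb_or => /andP[]; exists k.
Qed.

(** * Classification of the covariant maps *)

Section Entries.
Variables (C : numClosedFieldType) (n : nat).

Lemma delta_mulmxE (i j : 'I_n) (A : 'M[C]_n) p q :
  (delta_mx i j *m A) p q = (p == i)%:R * A j q.
Proof.
rewrite mxE (bigD1 j) //= big1 => [|k /negPf kj].
  by rewrite !mxE eqxx andbT addr0.
by rewrite !mxE kj andbF mul0r.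
Qed.

Lemma mulmx_deltaE (i j : 'I_n) (A : 'M[C]_n) p q :
  (A *m delta_mx i j) p q = A p i * (q == j)%:R.
Proof.
rewrite mxE (bigD1 i) //= big1 => [|k /negPf ki].
  by rewrite !mxE eqxx addr0.
by rewrite !mxE ki mulr0.
Qed.

Lemma mxtrace_delta (i j : 'I_n) : \tr (delta_mx i j : 'M[C]_n) = (i == j)%:R.
Proof.
rewrite /mxtrace (bigD1 i) //= big1 => [|k /negPf ki]; rewrite !mxE ?ki //.
by rewrite eqxx addr0.
Qed.

Lemma dotBl (u v w : 'cV[C]_n) : dot (u - v) w = dot u w - dot v w.
Proof. by rewrite -scaleN1r dotDl dotZl rmorphN rmorph1 mulN1r. Qed.

Lemma dotBr (u v w : 'cV[C]_n) : dot u (v - w) = dot u v - dot u w.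
Proof. by rewrite -scaleN1r dotDr dotZr mulN1r. Qed.

End Entries.

(** * The three-parameter family of covariant maps *)

Section BrauerMap.
Variables (C : numClosedFieldType) (d : nat).
Local Notation J := (Omega C d).

(** The flag puts both kinds of covariance into one family; under composition flags add modulo 2. *)
Definition twist (k : bool) (Z : 'M[C]_d) : 'M[C]_d :=
  if k then J *m Z *m J^T else Z.

(* With k = false this is (S, S)-covariant.  Since Omega S = conj S Omega on Sp,
   k = true gives the (S, conj S)-covariant maps. *)
Definition brauer_map (k : bool) (a b c : C) (Z : 'M[C]_d) : 'M[C]_d :=
  twist k ((a * \tr Z)%:M + b *: Z + c *: sigma Z).

Lemma twist_is_linear k : linear (twist k).
Proof.
by case: k => u X Y //=; rewrite /twist mulmxDr mulmxDl -scalemxAr -scalemxAl.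
Qed.

HB.instance Definition _ k :=
  GRing.isLinear.Build C 'M[C]_d 'M[C]_d _ (twist k) (twist_is_linear k).

Lemma sigma_is_linear : linear (@sigma C d).
Proof.
move=> u X Y; rewrite /sigma linearD linearZ /= mulmxDr mulmxDl.
by rewrite -scalemxAr -scalemxAl.
Qed.

HB.instance Definition _ :=
  GRing.isLinear.Build C 'M[C]_d 'M[C]_d _ (@sigma C d) sigma_is_linear.

Lemma brauer_map_is_linear k a b c : linear (brauer_map k a b c).
Proof.
move=> u X Y; rewrite /brauer_map -linearP; congr twist.
rewrite !linearP /=; move: (\tr X) (\tr Y) (sigma X) (sigma Y) => x y X' Y'.
by apply/matrixP => p q; rewrite !mxE; case: (p == q); rewrite ?mulr1n ?mulr0n; ring.
Qed.

HB.instance Definition _ k a b c :=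
  GRing.isLinear.Build C 'M[C]_d 'M[C]_d _ (brauer_map k a b c)
    (brauer_map_is_linear k a b c).

End BrauerMap.

Section Classification.
Variables (C : numClosedFieldType) (d : nat).
Hypotheses (d_ge4 : (4 <= d)%N) (d_even : ~~ odd d).
Local Notation J := (Omega C d).
Implicit Types (L : {linear 'M[C]_d -> 'M[C]_d}).

Let d_gt0 : (0 < d)%N := ltnW (ltnW (ltnW d_ge4)).
Let JJ : J *m J = - 1%:M := Omega_sqr C d_gt0 d_even.

Lemma Sp_conj (S : 'M[C]_d) : Sp S -> J *m S = conjmat S *m J.
Proof.
case=> uS SJS; rewrite -[in RHS]SJS !mulmxA.
have -> : conjmat S *m S^T = conjmat (S *m S^t*).
  apply/matrixP => i j; rewrite !mxE rmorph_sum; apply: eq_bigr => k _.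
  by rewrite !mxE rmorphM; congr (_ * _); exact/esym/conjCK.
by rewrite (unitarymxP uS) /conjmat map_mx1 mul1mx.
Qed.

Lemma Sp_conjr (S : 'M[C]_d) : Sp S -> J *m conjmat S = S *m J.
Proof.
move=> sS; have := congr1 (fun X => J *m X *m J) (Sp_conj sS).
rewrite !mulmxA JJ -!mulmxA JJ !(mulmxN, mulNmx) mul1mx mulmx1.
by move/oppr_inj => <-.
Qed.

Lemma Sp_conj_trmx (S : 'M[C]_d) : Sp S -> S^T *m J^T = J^T *m S^t*.
Proof.
move=> sS; rewrite -trmx_mul (Sp_conj sS) trmx_mul; congr (_ *m _).
by apply/matrixP => i j; rewrite !mxE.
Qed.

Lemma sigma_conj (S Z : 'M[C]_d) : Sp S -> sigma (S *m Z *m S^t*) = S *m sigma Z *m S^t*.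
Proof.
move=> sS; rewrite /sigma !trmx_mul.
have -> : (S^t*)^T = conjmat S by apply/matrixP => i j; rewrite !mxE.
by rewrite !mulmxA (Sp_conjr sS) -!mulmxA (Sp_conj_trmx sS).
Qed.

Lemma covariant_brauer (a b c : C) : covariantSS (brauer_map (d := d) false a b c).
Proof.
move=> S Z sS; have [uS _] := sS; rewrite /brauer_map /=.
rewrite mxtrace_mulC mulmxA unitary_adjmul // mul1mx sigma_conj //.
rewrite !mulmxDr !mulmxDl -!scalemxAr -!scalemxAl mul_mx_scalar -scalemxAl.
by rewrite (unitarymxP uS) scalemx1.
Qed.

Lemma partner_partner (x : 'cV[C]_d) : partner (partner x) = - x.
Proof. by rewrite {1}/partner conj_partner // mulmxA JJ mulNmx mul1mx. Qed.

Lemma partnerZ a (x : 'cV[C]_d) : partner (a *: x) = a^* *: partner x.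
Proof. by rewrite /partner /conjmat map_mxZ scalemxAr. Qed.

Lemma partner_basis (i : 'I_d) : exists (j : 'I_d) (s : C),
  [/\ j != i, s = 1 \/ s = -1, partner (basis C i) = s *: basis C j
    & partner (basis C j) = - s *: basis C i].
Proof.
have [j [s [ji s1 Ji]]] := Omega_col C d_gt0 d_even i.
have pi : partner (basis C i) = s *: basis C j.
  apply/matrixP => k l; rewrite (ord1 l) /partner mxE (bigD1 i) //= big1 => [|m mi].
    by rewrite Ji !mxE !eqxx conjC1 addr0 mulr1 andbT mulr_natr.
  by rewrite !mxE (negPf mi) conjC0 mulr0.
exists j, s; split=> //.
have ss : s * s = 1 by case: s1 => ->; rewrite ?mulrNN mulr1.
have sc : s^* = s by case: s1 => ->; rewrite ?(rmorphN, rmorph1).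
have := congr1 (fun x => s *: partner x) pi.
by rewrite partner_partner partnerZ sc !scalerA ss scale1r scalerN scaleNr.
Qed.

Lemma sigma_basis (i j : 'I_d) (s : C) : s = 1 \/ s = -1 ->
  partner (basis C i) = s *: basis C j ->
  sigma (delta_mx i i : 'M[C]_d) = delta_mx j j.
Proof.
move=> s1 pi; rewrite -outer_basis sigma_outer // pi adjmxZ.
rewrite -scalemxAl -scalemxAr scalerA outer_basis.
by case: s1 => ->; rewrite ?(rmorphN, rmorph1) ?mulrNN mulr1 scale1r.
Qed.

(** The image commutes with every e_k e_k^* for k other than the partner index j, hence is diagonal;
    commuting with the projections along e_k + e_m makes the diagonal constant outside i and j. *)
Lemma covariant_diag L i : covariantSS L -> exists a b c,
  L (delta_mx i i) = brauer_map false a b c (delta_mx i i).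
Proof.
move=> cL; have [j [s [ji s1 pi pj]]] := partner_basis i.
have s_n0 : s != 0 by case: s1 => ->; rewrite ?oppr_eq0 oner_eq0.
have [m [mi mj]] := ord_exists_neq2 i j (ltnW d_ge4).
have bn0 k : basis C k != 0 by rewrite -dot_eq0 dot_basis eqxx oner_eq0.
have orth k : k != j -> dot (partner (basis C k)) (basis C i) = 0.
  move=> kj; rewrite partner_skew // pi dotZl dot_basis eq_sym (negPf kj).
  by rewrite mulr0 oppr0.
set A := L _.
have comm k : k != j -> delta_mx k k *m A = A *m delta_mx k k.
  move=> kj; rewrite /A -!outer_basis; apply: covariant_comm => //.
  - exact: bn0.
  - exact: orth.
  by rewrite dot_basis; case: eqVneq => [->|_]; [left | right].
have Adiag k l : k != l -> A k l = 0.
  move=> kl; have [kj|kj] := eqVneq k j.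
    have lj : l != j by rewrite -kj eq_sym.
    have := congr1 (fun M : 'M_d => M k l) (comm l lj).
    by rewrite /= delta_mulmxE mulmx_deltaE (negPf kl) mul0r eqxx mulr1.
  have := congr1 (fun M : 'M_d => M k l) (comm k kj).
  by rewrite /= delta_mulmxE mulmx_deltaE eqxx mul1r [l == k]eq_sym (negPf kl) mulr0.
have Aeq k : k != i -> k != j -> A k k = A m m.
  move=> ki kj; have [->//|km] := eqVneq k m.
  have : (basis C k + basis C m) *m (basis C k + basis C m)^t* *m A
     = A *m ((basis C k + basis C m) *m (basis C k + basis C m)^t*).
    rewrite /A -outer_basis; apply: covariant_comm => //.
    - rewrite -dot_eq0 dotDl !dotDr !dot_basis !eqxx (negPf km) [m == k]eq_sym (negPf km).
      by rewrite addr0 add0r -natrD pnatr_eq0.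
    - rewrite partner_skew // dotDr opprD -!(partner_skew d_gt0 d_even _ (basis C i)).
      by rewrite !orth ?addr0.
    - by right; rewrite dotDl !dot_basis (negPf ki) (negPf mi) addr0.
  move/matrixP/(_ k m); rewrite !adjmxD !mulmxDl !mulmxDr !outer_basis.
  rewrite !mulmxDl ![fun_of_matrix (_ + _) _ _]mxE !delta_mulmxE !mulmx_deltaE.
  rewrite !eqxx (negPf km) [m == k]eq_sym (negPf km) (Adiag k m km).
  by rewrite !(mulr0, mul0r, mulr1, mul1r, addr0, add0r).
(* The diagonal entries should be a + b at i, a + c at j, and a elsewhere. *)
exists (A m m), (A i i - A m m), (A j j - A m m).
rewrite /brauer_map /= (sigma_basis s1 pi).
apply/matrixP => k l; rewrite mxtrace_delta !mxE eqxx mulr1.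
have [<-|kl] := eqVneq k l; last first.
  have off n : (k == n) && (l == n) = false.
    by apply: contraNF kl => /andP[/eqP-> /eqP->].
  by rewrite Adiag // !off !mulr0 !addr0 mulr0n.
rewrite !andbb.
have [->|ki] := eqVneq k i.
  by rewrite eq_sym (negPf ji) mulr0 mulr1 addr0 mulr1n addrC subrK.
have [->|kj] := eqVneq k j; first by rewrite mulr0 mulr1 addr0 mulr1n addrC subrK.
by rewrite !mulr0 !addr0 mulr1n Aeq.
Qed.

(* The transvection along x - y with z = -1 is a reflection sending x to y; the
   hypotheses on x and y say that their quaternionic inner product is real. *)
Lemma covariant_reflect L (x y : 'cV[C]_d) : covariantSS L -> L (x *m x^t*) = 0 ->
  dot x x = dot y y -> dot y x = dot x y -> dot (partner y) x = 0 ->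
  L (y *m y^t*) = 0.
Proof.
move=> cL Lx xy_norm xy_real pyx.
have [<- //|] := eqVneq x y.
rewrite -subr_eq0; set v := x - y => v0.
have dvx : dot v x = dot x x - dot y x by rewrite dotBl.
have dvv : dot v v = 2 * dot v x.
  by rewrite dvx /v dotBl !dotBr -xy_norm -xy_real; ring.
have dpv : dot (partner v) x = 0.
  by rewrite partner_skew // dotBr dot_partner // sub0r opprK partner_skew // pyx oppr0.
have Hx : sref v (-1) *m x = y.
  rewrite sref_mul dpv mulr0 scale0r addr0.
  have -> : (-1 - 1) / dot v v * dot v x = -1.
    have : dot v v != 0 by rewrite dot_eq0.
    by rewrite dvv mulf_eq0 negb_or => /andP[_ vx0]; field.
  by rewrite scaleN1r /v opprB addrC subrK.
have sH : Sp (sref v (-1)).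
  by apply: Sp_sref => //; rewrite ?(rmorphN, rmorph1) mulrNN mulr1.
rewrite -Hx adjmxM !mulmxA -(mulmxA _ x) cL // Lx mulmx0 mul0mx //.
Qed.

(* By reflection, L kills the rank-one matrix of 3 e_k + 4 z e_l for |z| = 1 (the
   coefficients 3, 4, 5 avoid square roots), hence the off-diagonal units. *)
Lemma covariant_eq0 L i : covariantSS L -> L (delta_mx i i) = 0 -> forall Z, L Z = 0.
Proof.
move=> cL Li.
have [j [s [ji s1 pi pj]]] := partner_basis i.
have [m [mi mj]] := ord_exists_neq2 i j (ltnW d_ge4).
have step k l : L (delta_mx k k) = 0 -> k != l ->
    dot (partner (basis C l)) (basis C k) = 0 -> L (delta_mx l l) = 0.
  rewrite -!outer_basis => Lk kl pkl; apply: (covariant_reflect cL Lk) => //.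
  - by rewrite !dot_basis !eqxx.
  - by rewrite !dot_basis (negPf kl) eq_sym (negPf kl).
have Lm k : k != j -> L (delta_mx k k) = 0.
  move=> kj; have [-> //|ki] := eqVneq k i.
  apply: (step i) => //; first by rewrite eq_sym.
  by rewrite partner_skew // pi dotZl dot_basis eq_sym (negPf kj) mulr0 oppr0.
have Lall k : L (delta_mx k k) = 0.
  have [->|/Lm//] := eqVneq k j.
  apply: (step m) => //; first exact: Lm.
  by rewrite pj dotZl dot_basis eq_sym (negPf mi) mulr0.
have Lpair k l z : k != l -> z * z^* = 1 -> 
  z^* *: L (delta_mx k l) + z *: L (delta_mx l k) = 0.
  move=> kl zz; pose y := 3 *: basis C k + (4 * z) *: basis C l.
  have Ly : L (y *m y^t*) = 0.
    have dyy : dot y y = 25.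
      rewrite dotDl !dotDr !dotZl !dotZr !dot_basis !eqxx (negPf kl).
      rewrite [l == k]eq_sym (negPf kl) !rmorphM /= !conjC_nat.
      by transitivity (9 + 16 * (z * z^*)); [ring | rewrite zz; ring].
    have d5 (n : 'I_d) : dot (5 *: basis C n) (5 *: basis C n) = 25.
      by rewrite dotZl dotZr dot_basis eqxx conjC_nat /=; ring.
    have [k' [t [k'k t1 pk pk']]] := partner_basis k.
    (* If e_l spans the partner line of e_k, the quaternionic product of y with 5 e_k has a nonzero
       partner component, so the reflection starts from a third basis vector, orthogonal to y and to
       its partner. Otherwise it starts from 5 e_k. *)
    have [lE|lk'] := eqVneq l k'.
      have [n [nk nl]] := ord_exists_neq2 k l (ltnW d_ge4).
      apply: (@covariant_reflect _ (5 *: basis C n)) => //.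
      - by rewrite adjmxZ -scalemxAl -scalemxAr outer_basis !linearZ /= Lall !scaler0.
      - by rewrite d5 dyy.
      - rewrite dotDl dotDr !dotZl !dotZr !dot_basis (negPf nk) (negPf nl).
        by rewrite [k == n]eq_sym [l == n]eq_sym (negPf nk) (negPf nl) !mulr0.
      - have h1 : dot (partner (basis C n)) (basis C k) = 0.
          by rewrite partner_skew // pk dotZl dot_basis -lE eq_sym (negPf nl) mulr0 oppr0.
        have h2 : dot (partner (basis C n)) (basis C l) = 0.
          rewrite partner_skew // lE pk' dotZl dot_basis eq_sym (negPf nk).
          by rewrite mulr0 oppr0.
        rewrite partner_skew // partnerZ dotZl dotDr !dotZr h1 h2.
        by rewrite !mulr0 addr0 mulr0 oppr0.
    apply: (@covariant_reflect _ (5 *: basis C k)) => //.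
    - by rewrite adjmxZ -scalemxAl -scalemxAr outer_basis !linearZ /= Lall !scaler0.
    - by rewrite d5 dyy.
    - rewrite dotDl dotDr !dotZl !dotZr !dot_basis eqxx (negPf kl) [l == k]eq_sym.
      by rewrite (negPf kl) !conjC_nat !mulr0 !addr0 mulrCA.
    - rewrite partner_skew // partnerZ pk !dotZl dotDr !dotZr !dot_basis.
      by rewrite (negPf k'k) [k' == l]eq_sym (negPf lk') !mulr0 addr0 !mulr0 oppr0.
  move: Ly; rewrite /y adjmxD !adjmxZ mulmxDl !mulmxDr -!scalemxAl -!scalemxAr.
  rewrite !outer_basis !linearD !linearZ /= !Lall !scaler0 add0r addr0.
  rewrite !scalerA rmorphM /= !conjC_nat => Ly.
  have := congr1 (fun X => 12^-1 *: X) Ly; rewrite scaler0 scalerDr !scalerA => <-.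
  by congr (_ *: _ + _ *: _); field.
have Lkl k l : L (delta_mx k l) = 0.
  have [->//|kl] := eqVneq k l.
  (* The values z = 1 and z = 'i give two independent relations between the images of the two
     off-diagonal units. *)
  have H1 := Lpair k l 1 kl; have Hi := Lpair k l 'i kl.
  move: H1 Hi; rewrite conjC1 conjCi mulr1 mulrN -expr2 sqrCi opprK !scale1r.
  move=> /(_ erefl)/eqP; rewrite addr_eq0 => /eqP -> /(_ erefl)/eqP.
  rewrite scalerN scaleNr opprK -mulr2n -scaler_nat scalerA scaler_eq0.
  by rewrite mulf_eq0 pnatr_eq0 (negPf (neq0Ci _)) /= => /eqP->; rewrite oppr0.
move=> Z; rewrite (matrix_sum_delta Z) linear_sum big1 // => k _.
by rewrite linear_sum big1 // => l _; rewrite linearZ /= Lkl scaler0.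
Qed.

(** A covariant map is determined by its value on one diagonal unit: the difference with the map
    fitted there is covariant and vanishes on it. *)
Theorem covariantSS_brauer L : covariantSS L -> exists a b c,
  forall Z, L Z = brauer_map false a b c Z.
Proof.
move=> cL; pose i := Ordinal d_gt0.
have [a [b [c Li]]] := covariant_diag i cL.
exists a, b, c => Z; apply/eqP; rewrite -subr_eq0.
have cD : covariantSS (L \- brauer_map false a b c).
  move=> S X sS /=; rewrite cL //.
  have /= -> := covariant_brauer a b c X sS.
  by rewrite mulmxBr mulmxBl.
by apply/eqP/(covariant_eq0 (i := i) cD); rewrite /= Li subrr.
Qed.

End Classification.

(** * Complete positivity *)

Section Choi.
Variables (C : numClosedFieldType) (d : nat).
Implicit Types (L : {linear 'M[C]_d -> 'M[C]_d}).

Lemma big_mxtens (F : 'I_(d * d) -> C) :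
  \sum_x F x = \sum_i \sum_k F (mxtens_index (i, k)).
Proof.
rewrite pair_bigA (reindex (@mxtens_index d d)) /=; last first.
  by exists (@mxtens_unindex d d) => x _; rewrite ?mxtens_indexK ?mxtens_unindexK.
by apply: eq_bigr => -[].
Qed.

Lemma choiE L i j k l :
  choi L (mxtens_index (i, k)) (mxtens_index (j, l)) = d%:R^-1 * L (delta_mx i j) k l.
Proof.
rewrite /choi mxE summxE; congr (_ * _).
rewrite (bigD1 i) //= [X in _ + X]big1 => [|i' /negPf i'i]; last first.
  by rewrite summxE big1 // => j' _; rewrite tensmxE !mxE eq_sym i'i mul0r.
rewrite summxE (bigD1 j) //= [X in _ + X + _]big1 => [|j' /negPf j'j].
  by rewrite tensmxE !mxE !eqxx mul1r !addr0.
by rewrite tensmxE !mxE [j == _]eq_sym j'j andbF mul0r.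
Qed.

Lemma eq_choi L1 L2 : (forall Z, L1 Z = L2 Z) -> choi L1 = choi L2.
Proof.
move=> L12; congr (_ *: _); apply: eq_bigr => i _; apply: eq_bigr => j _.
by rewrite L12.
Qed.

(** The second tensor factor of the Choi matrix carries the output of the map. *)
Lemma ptrans_choi L : ptrans (choi L) = choi (trmx \o L).
Proof.
apply/matrixP => x y; case: (mxtens_indexP x) => i k; case: (mxtens_indexP y) => j l.
by rewrite choiE /ptrans mxE !mxtens_indexK /= choiE mxE.
Qed.

Lemma PPTP L : PPT L <-> CP L /\ coCP L.
Proof. by rewrite /PPT ptrans_choi. Qed.

(* d times the quadratic form of the Choi matrix at the vector sum_i e_i (x) V e_i. *)
Definition choi_form L (V : 'M[C]_d) : C :=
  \sum_i \sum_j (V^t* *m L (delta_mx i j) *m V) i j.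

Lemma dot_choi L w : dot w (choi L *m w) =
  d%:R^-1 * choi_form L (\matrix_(k, i) w (mxtens_index (i, k)) 0).
Proof.
rewrite dotE big_mxtens /choi_form mulr_sumr; apply: eq_bigr => i _.
rewrite mulr_sumr; under eq_bigr => k _ do rewrite mxE big_mxtens mulr_sumr.
rewrite exchange_big; apply: eq_bigr => j _ /=.
under eq_bigr => k _.
  under eq_bigr => l _ do rewrite choiE.
  rewrite mulr_sumr; over.
rewrite exchange_big /= mxE mulr_sumr; apply: eq_bigr => l _.
rewrite !mxE mulr_suml mulr_sumr; apply: eq_bigr => k _.
by rewrite !mxE; ring.
Qed.

Lemma CP_formP L : (0 < d)%N -> CP L <-> forall V, 0 <= choi_form L V.
Proof.
move=> d_gt0; have d0 : 0 < d%:R^-1 :> C by rewrite invr_gt0 ltr0n.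
split=> [cpL V|pos].
  pose w : 'cV[C]_(d * d) :=
    \col_x V (mxtens_unindex x).2 (mxtens_unindex x).1.
  have := psdmx_dot w cpL; rewrite dot_choi pmulr_rge0 //.
  suff -> : \matrix_(k, i) w (mxtens_index (i, k)) 0 = V by [].
  by apply/matrixP => i j; rewrite !mxE mxtens_indexK.
by apply: psdmxP => v; rewrite dot_choi pmulr_rge0.
Qed.

Lemma eq_CP L1 L2 : (forall Z, L1 Z = L2 Z) -> CP L1 <-> CP L2.
Proof. by move=> /eq_choi eq12; rewrite /CP eq12. Qed.

End Choi.

(** * The Choi form of the family, and its behaviour under transposition *)

Section BrauerCP.
Variables (C : numClosedFieldType) (d : nat).
Hypotheses (d_ge4 : (4 <= d)%N) (d_even : ~~ odd d).
Local Notation J := (Omega C d).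

Let d_gt0 : (0 < d)%N := ltnW (ltnW (ltnW d_ge4)).
Let trJ : J^T = - J := tr_Omega C d_gt0 d_even.
Let JJ : J *m J = - 1%:M := Omega_sqr C d_gt0 d_even.

Lemma mulJtrJ : J *m J^T = 1%:M.
Proof. by rewrite trJ mulmxN JJ opprK. Qed.

Lemma multrJJ : J^T *m J = 1%:M.
Proof. exact/mulmx1C/mulJtrJ. Qed.

Lemma adj_trJ : J^T^t* = J.
Proof. by rewrite trmxK; exact: conj_Omega. Qed.

Lemma mulmx_delta_mulmxE n (A B : 'M[C]_n) i j p q :
  (A *m delta_mx i j *m B) p q = A p i * B j q.
Proof.
rewrite mxE (bigD1 j) //= big1 => [|k /negPf kj]; rewrite mulmx_deltaE.
  by rewrite eqxx mulr1 addr0.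
by rewrite kj mulr0 mul0r.
Qed.

(** The quadratic form of the flip operator: plus the squared norm on symmetric W, minus it on
    skew-symmetric W. *)
Definition swap_form (W : 'M[C]_d) : C := \sum_i \sum_j (W j i)^* * W i j.

(* choi_form of the map with coefficients a, b, c, in the variable W = J^T V. *)
Definition brauer_form (a b c : C) (W : 'M[C]_d) : C :=
  a * \tr (W^t* *m W) + b * ((\tr (J *m W))^* * \tr (J *m W)) + c * swap_form W.

Lemma twistK k (Z : 'M[C]_d) : twist k (twist k Z) = Z.
Proof.
case: k => //=; rewrite !mulmxA JJ -!mulmxA -trmx_mul JJ linearN /= trmx1.
by rewrite !(mulNmx, mulmxN) opprK mul1mx mulmx1.
Qed.

Lemma twistC k k' (Z : 'M[C]_d) : twist k (twist k' Z) = twist (k (+) k') Z.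
Proof. by case: k; case: k' => //; rewrite twistK. Qed.

Lemma sigmaE (Z : 'M[C]_d) : sigma Z = twist true Z^T.
Proof. by []. Qed.

(** The trace map contributes the squared norm of V, the identity the squared modulus of its trace,
    and sigma the flip form of J^T V. A twist is absorbed into V. *)
Lemma choi_form_brauer k (a b c : C) (V : 'M[C]_d) :
  choi_form (brauer_map (d := d) k a b c) V =
  brauer_form a b c (J^T *m (if k then J^T *m V else V)).
Proof.
transitivity (choi_form (brauer_map (d := d) false a b c) (if k then J^T *m V else V)).
  case: k => //; apply: eq_bigr => i _; apply: eq_bigr => j _.
  by rewrite /brauer_map /= adjmxM adj_trJ -!mulmxA.
move: (if k then _ else _) => {k}V.
rewrite /brauer_form mulmxA mulJtrJ mul1mx.
transitivity (\sum_i \sum_j (a * ((i == j)%:R * (V^t* *m V) i j)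
   + b * ((V i i)^* * V j j) + c * (((J^T *m V) j i)^* * (J^T *m V) i j))).
  apply: eq_bigr => i _; apply: eq_bigr => j _.
  rewrite /brauer_map /= mxtrace_delta /sigma trmx_delta.
  rewrite !mulmxDr !mulmxDl -!scalemxAr -!scalemxAl mul_mx_scalar -scalemxAl.
  rewrite !mulmxA -{1}adj_trJ -adjmxM -(mulmxA _ J^T V).
  rewrite ![(_ + _ : 'M_d) i j]mxE ![(_ *: _ : 'M_d) i j]mxE !mulmx_delta_mulmxE.
  by rewrite !adjmxE -[a * _ * _]mulrA.
rewrite adjmxM adj_trJ -mulmxA (mulmxA J) mulJtrJ mul1mx.
under eq_bigr do rewrite !big_split -!mulr_sumr /=.
rewrite !big_split -!mulr_sumr /= -mulr_suml; congr (_ + _ + _).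
  congr (_ * _); apply: eq_bigr => i _.
  rewrite (bigD1 i) //= big1 ?eqxx ?mul1r ?addr0 // => j.
  by rewrite eq_sym => /negPf ->; rewrite mul0r.
by rewrite -rmorph_sum.
Qed.

Lemma CP_brauer k (a b c : C) :
  CP (brauer_map (d := d) k a b c) <-> forall W, 0 <= brauer_form a b c W.
Proof.
rewrite CP_formP //; split=> H W; last by rewrite choi_form_brauer.
have := H (J *m (if k then J *m W else W)); rewrite choi_form_brauer.
case: k {H} => /=; rewrite ?[J^T *m (J *m (J *m _))]mulmxA ?multrJJ ?mul1mx;
  by rewrite mulmxA multrJJ mul1mx.
Qed.

Lemma trmx_twist k (X : 'M[C]_d) : (twist k X)^T = twist k X^T.
Proof. by case: k => //; rewrite /twist !trmx_mul trmxK mulmxA. Qed.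

(** Since sigma is the twisted transpose and twisting is an involution, transposition exchanges the
    identity and sigma up to a twist; this reduces co-CP to CP. *)
Lemma trmx_brauer k (a b c : C) Z :
  (brauer_map (d := d) k a b c Z)^T = brauer_map (~~ k) a c b Z.
Proof.
rewrite /brauer_map trmx_twist !linearD !linearZ /= tr_scalar_mx sigmaE trmx_twist trmxK.
rewrite -addbT -!twistC twistK.
have -> : twist true (a * \tr Z)%:M = (a * \tr Z)%:M :> 'M[C]_d.
  by rewrite /twist mul_mx_scalar -scalemxAl mulJtrJ scalemx1.
by rewrite addrAC.
Qed.

Lemma coCP_brauer k (a b c : C) :
  coCP (brauer_map (d := d) k a b c) <-> forall W, 0 <= brauer_form a c b W.
Proof.
rewrite -(CP_brauer (~~ k)) /coCP; apply: eq_CP => Z /=; exact: trmx_brauer.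
Qed.

End BrauerCP.

(** * Conditions on the coefficients, and the composition law *)

Section Coefficients.
Variables (C : numClosedFieldType) (d : nat).
Hypotheses (d_ge4 : (4 <= d)%N) (d_even : ~~ odd d).
Local Notation J := (Omega C d).
Local Notation brauer := (@brauer_map C d).

Let d_gt0 : (0 < d)%N := ltnW (ltnW (ltnW d_ge4)).
Let adjJ : J^t* = - J := adj_Omega C d_gt0 d_even.
Let JJ : J *m J = - 1%:M := Omega_sqr C d_gt0 d_even.

(** The convex cone of coefficients of CP maps, the same for both flags. *)
Definition cp_coef (a b c : C) := forall W : 'M[C]_d, 0 <= brauer_form a b c W.

Lemma cp_coefD a b c a' b' c' :
  cp_coef a b c -> cp_coef a' b' c' -> cp_coef (a + a') (b + b') (c + c').
Proof.
move=> H H' W; have := addr_ge0 (H W) (H' W).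
by congr (_ <= _); rewrite /brauer_form; ring.
Qed.

Lemma cp_coefZ t a b c : 0 <= t -> cp_coef a b c -> cp_coef (t * a) (t * b) (t * c).
Proof.
move=> t0 H W; have := mulr_ge0 t0 (H W).
by congr (_ <= _); rewrite /brauer_form; ring.
Qed.

Lemma tr_adj_mulmx (W : 'M[C]_d) :
  \tr (W^t* *m W) = \sum_i \sum_j (W i j)^* * W i j.
Proof.
rewrite exchange_big; apply: eq_bigr => i _; rewrite mxE.
by apply: eq_bigr => j _; rewrite adjmxE.
Qed.

Lemma cp_coef_trace : cp_coef 1 0 0.
Proof.
move=> W; rewrite /brauer_form mul1r !mul0r !addr0 tr_adj_mulmx.
by do 2 apply: sumr_ge0 => ? _; rewrite mulrC mul_conjC_ge0.
Qed.

Lemma cp_coef_id : cp_coef 0 1 0.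
Proof.
by move=> W; rewrite /brauer_form mul1r !mul0r add0r addr0 mulrC mul_conjC_ge0.
Qed.

(** The form is half the squared norm of W - W^T. *)
Lemma cp_coef_trace_sub_sigma : cp_coef 1 0 (-1).
Proof.
move=> W; rewrite /brauer_form mul1r mul0r addr0 tr_adj_mulmx /swap_form.
have E : \sum_i \sum_j (W i j)^* * W i j - \sum_i \sum_j (W j i)^* * W i j
   = 2^-1 * \sum_i \sum_j (W i j - W j i) * (W i j - W j i)^*.
  transitivity (2^-1 * (\sum_i \sum_j (W i j)^* * W i j
      + \sum_i \sum_j (W j i)^* * W j i - \sum_i \sum_j (W j i)^* * W i j
      - \sum_i \sum_j (W i j)^* * W j i)).
    rewrite [\sum_i \sum_j (W j i)^* * W j i]exchange_big.
    by rewrite [\sum_i \sum_j (W i j)^* * W j i]exchange_big /=; field.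
  congr (_ * _); rewrite -big_split -!sumrB; apply: eq_bigr => i _.
  rewrite -big_split -!sumrB; apply: eq_bigr => j _.
  by rewrite rmorphB /=; ring.
rewrite mulN1r E mulr_ge0 ?invr_ge0 ?ler0n //.
by do 2 apply: sumr_ge0 => ? _; rewrite mul_conjC_ge0.
Qed.

Lemma swap_formE (W : 'M[C]_d) : swap_form W = \tr (conjmat W *m W).
Proof.
rewrite /swap_form exchange_big; apply: eq_bigr => j _; rewrite mxE.
by apply: eq_bigr => i _; rewrite mxE.
Qed.

Lemma conj_delta (i j : 'I_d) : conjmat (delta_mx i j) = delta_mx i j :> 'M[C]_d.
Proof. by apply/matrixP => k l; rewrite !mxE conjC_nat. Qed.

Lemma adj_delta (i j : 'I_d) : (delta_mx i j)^t* = delta_mx j i :> 'M[C]_d.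
Proof. by rewrite trmx_delta; exact: conj_delta. Qed.

Lemma mxtrace_Omega_delta i j : \tr (J *m delta_mx i j) = J j i.
Proof.
rewrite /mxtrace (bigD1 j) //= big1 => [|k /negPf kj]; rewrite mulmx_deltaE.
  by rewrite eqxx mulr1 addr0.
by rewrite kj mulr0.
Qed.

Lemma Omega_diag i : J i i = 0.
Proof.
by have /eqP := Omega_skew C d_gt0 d_even i i;
   rewrite -subr_eq0 opprK -mulr2n mulrn_eq0 /= => /eqP.
Qed.

(** Test on a symmetric W, where the flip form equals the squared norm and the trace of J W
    vanishes. *)
Lemma cp_coef_sym a b c : cp_coef a b c -> 0 <= a + c.
Proof.
move=> H; pose i := Ordinal d_gt0; have := H (delta_mx i i).
rewrite /brauer_form mxtrace_Omega_delta Omega_diag mulr0 mulr0 addr0.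
by rewrite swap_formE conj_delta adj_delta mul_delta_mx mxtrace_delta eqxx !mulr1.
Qed.

(** Test on a skew-symmetric W with the trace of J W zero; the index m is taken off the partner of i
    to ensure this. *)
Lemma cp_coef_skew a b c : cp_coef a b c -> 0 <= a - c.
Proof.
move=> H; pose i := Ordinal d_gt0.
have [j [s [ji s1 Ji]]] := Omega_col C d_gt0 d_even i.
have [m [mi mj]] := ord_exists_neq2 i j (ltnW d_ge4).
have im : i != m by rewrite eq_sym.
have Jmi : J m i = 0 by rewrite Ji (negPf mj).
have tr0 : \tr (J *m (delta_mx i m - delta_mx m i)) = 0.
  rewrite mulmxBr linearB /= !mxtrace_Omega_delta (Omega_skew _ _ _ i) //.
  by rewrite Jmi oppr0 subrr.
have := H (delta_mx i m - delta_mx m i).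
rewrite /brauer_form tr0 mulr0 mulr0 addr0.
rewrite swap_formE.
have -> : conjmat (delta_mx i m - delta_mx m i : 'M[C]_d) = delta_mx i m - delta_mx m i.
  by rewrite /conjmat map_mxB; congr (_ - _); exact: conj_delta.
have -> : (delta_mx i m - delta_mx m i : 'M[C]_d)^t* = delta_mx m i - delta_mx i m.
  by rewrite linearB /= map_mxB; congr (_ - _); exact: adj_delta.
rewrite !mulmxBl !mulmxBr !mul_delta_mx !mul_delta_mx_0 //.
rewrite !linearB !linear0 /= !mxtrace_delta !eqxx.
have -> : a * (1 - 0 - (0 - 1)) + c * (0 - 1 - (1 - 0)) = 2 * (a - c) by ring.
by rewrite pmulr_rge0 ?ltr0n.
Qed.

(** Test on W = J: skew-symmetric of squared norm d, with the trace of J W equal to -d. *)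
Lemma cp_coef_omega a b c : cp_coef a b c -> 0 <= a + b * d%:R - c.
Proof.
move=> H; have := H J; rewrite /brauer_form adjJ JJ mulNmx JJ opprK.
rewrite linearN /= mxtrace1.
have -> : swap_form J = - d%:R.
  by rewrite swap_formE conj_Omega // JJ linearN /= mxtrace1.
rewrite rmorphN /= conjC_nat mulrNN mulrN.
have -> : a * d%:R + b * (d%:R * d%:R) - c * d%:R = d%:R * (a + b * d%:R - c) by ring.
by rewrite pmulr_rge0 ?ltr0n.
Qed.

(** With t the trace map, t t = d t, t sigma = sigma t = t and sigma sigma = 1; twisting commutes
    with sigma and preserves trace and scalars. *)
Lemma brauer_comp k k' a b c a' b' c' Z :
  brauer k a b c (brauer k' a' b' c' Z) =
  brauer (k (+) k') (d%:R * a * a' + a * (b' + c') + (b + c) * a')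
    (b * b' + c * c') (b * c' + c * b') Z.
Proof.
have twist1 (x : C) : twist k' x%:M = x%:M :> 'M[C]_d.
  case: (k') => //; rewrite /twist mul_mx_scalar -scalemxAl mulJtrJ //.
  by rewrite scalemx1.
have twist_tr (X : 'M[C]_d) : \tr (twist k' X) = \tr X.
  by case: (k') => //; rewrite /twist mxtrace_mulC mulmxA multrJJ // mul1mx.
have twist_sig (X : 'M[C]_d) : sigma (twist k' X) = twist k' (sigma X).
  by case: (k') => //; rewrite /sigma /twist !trmx_mul trmxK !mulmxA.
have sig1 (x : C) : sigma x%:M = x%:M :> 'M[C]_d.
  by rewrite /sigma tr_scalar_mx mul_mx_scalar -scalemxAl mulJtrJ // scalemx1.
have sig_tr (X : 'M[C]_d) : \tr (sigma X) = \tr X.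
  by rewrite /sigma mxtrace_mulC mulmxA multrJJ // mul1mx mxtrace_tr.
have sigK (X : 'M[C]_d) : sigma (sigma X) = X.
  by rewrite !sigmaE trmx_twist // trmxK twistK.
rewrite /brauer_map -(twistC d_ge4 d_even); congr twist.
rewrite twist_tr !twist_sig -[(_ * \tr _)%:M]twist1 -!linearZ -!linearD /=.
congr twist; rewrite !linearD !linearZ /= sig1 sigK sig_tr mxtrace_scalar.
rewrite -[_ *+ d]mulr_natr.
move: (\tr Z) (sigma Z) => t S.
apply/matrixP => p q; rewrite !mxE; case: (p == q); rewrite ?mulr1n ?mulr0n; ring.
Qed.

(** Following the map by conjugation by J turns the conjugate of S into S, which reduces to the
    other covariance. *)
Lemma covariantSSbar_brauer (L : {linear 'M[C]_d -> 'M[C]_d}) :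
  covariantSSbar L -> exists a b c, forall Z, L Z = brauer true a b c Z.
Proof.
move=> cL; have cL' : covariantSS (twist true \o L).
  move=> S Z sS /=; rewrite cL // adjmx_conj !mulmxA Sp_conjr //.
  by rewrite -!mulmxA Sp_conj_trmx //.
have [a [b [c H]]] := covariantSS_brauer d_ge4 d_even cL'.
exists a, b, c => Z; rewrite -[LHS](twistK d_ge4 d_even true).
by have /= -> := H Z.
Qed.

Lemma psd_outer n (x : 'cV[C]_n) : psdmx (x *m x^t*).
Proof.
apply: psdmxP => v; rewrite outer_mul dotZr [dot v x]dotC.
exact: mul_conjC_ge0.
Qed.

Lemma twist_dot k (X : 'M[C]_d) v : exists v', dot v (twist k X *m v) = dot v' (X *m v').
Proof.
case: k; last by exists v.
by exists (J^T *m v); rewrite /twist /dot adjmxM adj_trJ // !mulmxA.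
Qed.

Lemma psd_twist k (X : 'M[C]_d) : psdmx X -> psdmx (twist k X).
Proof.
by move=> pX; apply: psdmxP => v; have [v' ->] := twist_dot k X v; exact: psdmx_dot.
Qed.

(** The untwisted image of e_i e_i^* is diagonal, with entries a + b at i, a + c at the partner
    index and a elsewhere. *)
Lemma positive_brauer k a b c : positive_map (brauer k a b c) ->
  [/\ 0 <= a, 0 <= a + b & 0 <= a + c].
Proof.
move=> pos; pose i := Ordinal d_gt0.
have [j [s [ji s1 pi pj]]] := partner_basis C d_ge4 d_even i.
have [m [mi mj]] := ord_exists_neq2 i j (ltnW d_ge4).
have psd : psdmx ((a)%:M + b *: delta_mx i i + c *: delta_mx j j : 'M[C]_d).
  have := psd_twist k (pos _ (psd_outer (basis C i))).
  rewrite outer_basis /brauer_map twistK // mxtrace_delta eqxx mulr1.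
  by rewrite (sigma_basis d_ge4 d_even s1 pi).
have entry n := psdmx_dot (basis C n) psd.
have {}entry n : 0 <= a + b * (n == i)%:R + c * (n == j)%:R.
  have := entry n; rewrite dot_basisl !mulmxDl -!scalemxAl mul_scalar_mx.
  rewrite -!outer_basis !outer_mul !dot_basis !mxE !eqxx.
  rewrite !andbT mulr1 [i == n]eq_sym [j == n]eq_sym.
  by case: eqP => _; case: eqP => _ //=; rewrite ?mulr0 ?mul0r ?mulr1.
split.
- by have := entry m; rewrite (negPf mi) (negPf mj) !mulr0 !addr0.
- by have := entry i; rewrite eqxx eq_sym (negPf ji) mulr0 mulr1 addr0.
- by have := entry j; rewrite eqxx (negPf ji) mulr0 mulr1 addr0.
Qed.

(** Bessel's inequality for the orthogonal pair formed by x and its partner, which have equal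
    norm. *)
Lemma bessel (x v : 'cV[C]_d) :
  dot x v * (dot x v)^* + dot (partner x) v * (dot (partner x) v)^*
   <= dot x x * dot v v.
Proof.
have [->|x0] := eqVneq x 0.
  have dot0 (u : 'cV[C]_d) : dot 0 u = 0 by rewrite -(scale0r 0) dotZl rmorph0 mul0r.
  have -> : partner (0 : 'cV[C]_d) = 0 by rewrite -(scale0r 0) partnerZ rmorph0 !scale0r.
  by rewrite !dot0 !mul0r addr0.
have N0 : 0 < dot x x by rewrite lt0r dot_eq0 x0 dot_ge0.
rewrite -subr_ge0 -(pmulr_rge0 _ N0).
(* This is the residual of v off the span of the pair, scaled by [dot x x] to avoid division. *)
have := dot_ge0 (dot x x *: v - dot x v *: x - dot (partner x) v *: partner x).
congr (_ <= _).
rewrite !dotBl !dotBr !dotZl !dotZr dot_partner' // dot_partner // dot_partner_partner //.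
by rewrite (dotC v x) (dotC v (partner x)) conj_dot_self; ring.
Qed.

(** The form splits as p times the Bessel defect plus p + q and p + r times squared moduli. *)
Lemma psd_brauer_outer k (p q r : C) (x : 'cV[C]_d) :
  0 <= p -> 0 <= p + q -> 0 <= p + r ->
  psdmx (brauer k p q r (x *m x^t*)).
Proof.
move=> p0 pq pr; apply: psd_twist; apply: psdmxP => v.
rewrite sigma_outer // !mulmxDl -!scalemxAl !outer_mul mul_scalar_mx !dotDr !dotZr.
have -> : \tr (x *m x^t*) = dot x x by rewrite mxtrace_mulC /mxtrace big_ord1.
rewrite [dot v x]dotC [dot v (partner x)]dotC.
set B := dot x v; set B' := dot (partner x) v.
have -> : p * dot x x * dot v v + q * (B * B^*) + r * (B' * B'^*) =
  p * (dot x x * dot v v - (B * B^* + B' * B'^*))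
  + (p + q) * (B * B^*) + (p + r) * (B' * B'^*).
  by ring.
apply: addr_ge0; first apply: addr_ge0.
- by rewrite mulr_ge0 // subr_ge0 bessel.
- by rewrite mulr_ge0 // mul_conjC_ge0.
- by rewrite mulr_ge0 // mul_conjC_ge0.
Qed.

End Coefficients.

(** * Entanglement breaking *)

Section Design.
Variables (C : numClosedFieldType) (d : nat).

Definition phase (f : {ffun 'I_d -> 'I_4}) : 'cV[C]_d := \col_i 'i ^+ f i.

Lemma expCi_mod4 n : 'i ^+ (n %% 4) = 'i ^+ n :> C.
Proof.
apply: expr_mod; rewrite (_ : 4 = 2 * 2)%N // exprM sqrCi.
by rewrite sqrrN expr1n.
Qed.

Lemma phase_shift f m i : phase (f + [ffun i => if i == m then 1 else 0]) i 0 =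
  (if i == m then 'i else 1) * phase f i 0.
Proof.
rewrite !mxE !ffunE; case: eqP => _; last by rewrite addr0 mul1r.
by rewrite /= expCi_mod4 exprD expr1 mulrC.
Qed.

Lemma norm_phase f i : (phase f i 0)^* * phase f i 0 = 1.
Proof.
by rewrite mxE rmorphXn /= conjCi -exprMn mulNr -expr2 sqrCi opprK expr1n.
Qed.

(* Shifting one phase by 'i multiplies the sum by a fourth root of unity, so it
   vanishes unless the index pairs {i, l} and {j, k} match. *)
Lemma phase_moment i j k l :
  \sum_f (phase f i 0)^* * phase f j 0 * (phase f k 0 * (phase f l 0)^*) =
  (4 ^ d)%:R * ((i == j)%:R * (k == l)%:R + (i == k)%:R * (j == l)%:R
     - (i == j)%:R * (j == k)%:R * (k == l)%:R).
Proof.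
pose w (m n : 'I_d) : C := if m == n then 'i else 1.
have vanish (i' j' k' l' n : 'I_d) : (w i' n)^* * w j' n * (w k' n * (w l' n)^*) != 1 ->
   \sum_f (phase f i' 0)^* * phase f j' 0 * (phase f k' 0 * (phase f l' 0)^*) = 0.
  set S := \sum_f _ => w1.
  have : S = (w i' n)^* * w j' n * (w k' n * (w l' n)^*) * S.
    rewrite {1}/S (reindex_inj (addIr [ffun i => if i == n then 1 else 0])) mulr_sumr /=.
    by apply: eq_bigr => f _; rewrite !phase_shift -!/(w _ n) !rmorphM /=; ring.
  move/eqP; rewrite -subr_eq0 -[X in X - _]mul1r -mulrBl mulf_eq0 subr_eq0 eq_sym.
  by rewrite (negPf w1) /= => /eqP.
have card : \sum_(f : {ffun 'I_d -> 'I_4}) 1 = (4 ^ d)%:R :> C.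
  by rewrite sumr_const card_ffun !card_ord.
have i1 : 'i != 1 :> C.
  by apply/eqP => /(congr1 (fun x => x ^+ 2)); rewrite sqrCi expr1n => /eqP;
     rewrite eq_sym -subr_eq0 opprK -(natrD _ 1 1) pnatr_eq0.
have ni1 : - 'i != 1 :> C.
  by apply/eqP => /(congr1 (fun x => x ^+ 2)); rewrite sqrrN sqrCi expr1n => /eqP;
     rewrite eq_sym -subr_eq0 opprK -(natrD _ 1 1) pnatr_eq0.
have n11 : -1 != 1 :> C.
  by rewrite eq_sym -subr_eq0 opprK -(natrD _ 1 1) pnatr_eq0.
have [<-|ij] := eqVneq i j.
  have [<-|kl] := eqVneq k l.
    have -> : 1 * 1 + (i == k)%:R * (i == k)%:R - 1 * (i == k)%:R * 1 = 1 :> C.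
      by case: (i == k); rewrite !(mulr0, mulr1, mul0r, subr0, addr0) ?addrK.
    rewrite mulr1 -card; apply: eq_bigr => f _.
    by rewrite [_ * (phase f k 0)^*]mulrC !norm_phase mulr1.
  rewrite !mulr0 add0r subr0.
  have [ik|ik] := eqVneq i k; last first.
    rewrite mul0r mulr0; apply: (vanish _ _ _ _ k).
    by rewrite /w eqxx (negPf ik) [l == k]eq_sym (negPf kl) !conjC1 !mulr1 mul1r.
  rewrite ik (negPf kl) !mulr0; apply: (vanish _ _ _ _ l).
  by rewrite /w eqxx (negPf kl) conjC1 conjCi !mul1r.
rewrite !mul0r subr0 add0r.
have [<-|ik] := eqVneq i k; last first.
  rewrite mul0r mulr0; apply: (vanish _ _ _ _ i).
  rewrite /w eqxx [j == i]eq_sym [k == i]eq_sym (negPf ij) (negPf ik) mulr1 mul1r.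
  by case: (l == i); rewrite conjCi ?conjC1 ?mulr1 // mulrNN -expr2 sqrCi.
rewrite mul1r; have [<-|jl] := eqVneq j l; last first.
  rewrite mulr0; apply: (vanish _ _ _ _ j).
  by rewrite /w eqxx (negPf ij) [l == j]eq_sym (negPf jl) !conjC1 !mulr1 mul1r.
rewrite mulr1 -card; apply: eq_bigr => f _.
by rewrite mulrACA norm_phase [_ * (phase f j 0)^*]mulrC norm_phase mulr1.
Qed.

Lemma sum_deltal (m : 'I_d) (F : 'I_d -> C) : \sum_j (m == j)%:R * F j = F m.
Proof.
rewrite (bigD1 m) //= big1 ?eqxx ?mul1r ?addr0 // => j.
by rewrite eq_sym => /negPf ->; rewrite mul0r.
Qed.

(** Averaging over the phase vectors gives the left side minus the diagonal part of Z; the basis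
    vectors restore it. *)
Lemma trace_id_design (Z : 'M[C]_d) : (\tr Z)%:M + Z =
  \sum_f (4 ^ d)%:R^-1 *: (dot (phase f) (Z *m phase f) *: (phase f *m (phase f)^t*))
  + \sum_i dot (basis C i) (Z *m basis C i) *: (basis C i *m (basis C i)^t*).
Proof.
apply/matrixP => k l.
have outerE (u : 'cV[C]_d) : (u *m u^t*) k l = u k 0 * (u l 0)^*.
  by rewrite mxE big_ord1 adjmxE.
have dotE' (u : 'cV[C]_d) : dot u (Z *m u) = \sum_i \sum_j Z i j * ((u i 0)^* * u j 0).
  rewrite dotE; apply: eq_bigr => i _; rewrite mxE mulr_sumr.
  by apply: eq_bigr => j _; ring.
have scalemxE a (M : 'M[C]_d) : (a *: M) k l = a * M k l by rewrite mxE.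
have n0 : (4 ^ d)%:R != 0 :> C by rewrite pnatr_eq0 expn_eq0.
transitivity (\sum_i \sum_j Z i j * ((i == j)%:R * (k == l)%:R + (i == k)%:R * (j == l)%:R
     - (i == j)%:R * (j == k)%:R * (k == l)%:R) + (k == l)%:R * Z k k).
  transitivity (\sum_i ((Z i i * (k == l)%:R + (k == i)%:R * Z i l)
      - (k == i)%:R * (Z i i * (k == l)%:R)) + (k == l)%:R * Z k k).
    rewrite sumrB big_split /= -!mulr_suml !sum_deltal !mxE.
    by rewrite [Z k k * _]mulrC subrK; case: (k == l); rewrite ?mulr1 ?mulr0.
  congr (_ + _); apply: eq_bigr => i _.
  transitivity (\sum_j ((i == j)%:R * (Z i j * (k == l)%:R)
      + (l == j)%:R * ((i == k)%:R * Z i j)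
      - (i == j)%:R * ((j == k)%:R * (Z i j * (k == l)%:R)))).
    by rewrite sumrB big_split /= !sum_deltal [k == i]eq_sym.
  by apply: eq_bigr => j _; rewrite [l == j]eq_sym; ring.
rewrite mxE !summxE; congr (_ + _).
  transitivity ((4 ^ d)%:R^-1 * \sum_i \sum_j \sum_f
     Z i j * ((phase f i 0)^* * phase f j 0 * (phase f k 0 * (phase f l 0)^*))).
    rewrite mulr_sumr; apply: eq_bigr => i _; rewrite mulr_sumr; apply: eq_bigr => j _.
    by rewrite -mulr_sumr phase_moment; field.
  rewrite mulr_sumr.
  under eq_bigr => i _ do rewrite exchange_big mulr_sumr.
  rewrite exchange_big; apply: eq_bigr => f _ /=.
  rewrite !scalemxE outerE -mulr_sumr dotE' mulr_suml; congr (_ * _).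
  apply: eq_bigr => i _; rewrite mulr_suml; apply: eq_bigr => j _.
  by rewrite mulrA.
have basisE (i : 'I_d) :
    (dot (basis C i) (Z *m basis C i) *: (basis C i *m (basis C i)^t*)) k l
    = Z i i * ((k == i)%:R * (l == i)%:R).
  rewrite mxE outerE dot_basisl !mxE !andbT conjC_nat (bigD1 i) //= big1 => [|j ji].
    by rewrite !mxE !eqxx mulr1 addr0.
  by rewrite !mxE (negPf ji) mulr0.
rewrite (bigD1 k) //= big1 => [|i ik]; rewrite basisE.
  by rewrite eqxx mul1r addr0 [l == k]eq_sym mulrC.
by rewrite [k == i]eq_sym (negPf ik) mul0r mulr0.
Qed.

End Design.

Section EntanglementBreaking.
Variables (C : numClosedFieldType) (d : nat).

(** A measure-and-prepare map has a separable Choi matrix. The first factor uses the conjugate of x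
    t, since measuring [delta_mx i j] yields the (i, j) entry of the projection along that
    conjugate. *)
Lemma separable_measure (T : finType) (L : {linear 'M[C]_d -> 'M[C]_d})
    (x : T -> 'cV[C]_d) (Y : T -> 'M[C]_d) :
  (forall Z, L Z = \sum_t dot (x t) (Z *m x t) *: Y t) ->
  (forall t, psdmx (Y t)) -> entanglement_breaking L.
Proof.
move=> LE pY; exists #|T|.
exists (fun k => let u := conjmat (x (enum_val k)) in u *m u^t*).
exists (fun k => d%:R^-1 *: Y (enum_val k)).
split=> [k|].
  split; first exact: psd_outer.
  apply: psdmxP => v; rewrite -scalemxAl dotZr mulr_ge0 ?invr_ge0 ?ler0n //.
  exact: psdmx_dot.
apply/matrixP => p q.
case: (mxtens_indexP p) => i k; case: (mxtens_indexP q) => j l.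
rewrite choiE LE !summxE mulr_sumr.
rewrite (reindex (@enum_val T T)) /=; last exact: (onW_bij _ (enum_val_bij T)).
rewrite [LHS](eq_bigl predT) //.
apply: eq_bigr => n _; rewrite tensmxE -outer_basis outer_mul dot_basisl dotZr.
rewrite [dot _ (basis _ _)]dotC dot_basisl !mxE big_ord1 !mxE conjCK.
by ring.
Qed.

End EntanglementBreaking.

(** * Entanglement breaking and decomposability from coefficients *)

Section Composition.
Variables (C : numClosedFieldType) (d : nat).
Hypotheses (d_ge4 : (4 <= d)%N) (d_even : ~~ odd d).
Local Notation brauer := (@brauer_map C d).

(* The map factors as P after Z |-> (\tr Z)%:M + Z, where P has coefficients p, b, c
   and is positive on rank-one matrices by Bessel's inequality. *)
Lemma entanglement_breaking_brauer (L : {linear 'M[C]_d -> 'M[C]_d}) k (a b c : C) :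
  (forall Z, L Z = brauer k a b c Z) ->
  0 <= a - b - c -> 0 <= a + b * d%:R - c -> 0 <= a - b + c * d%:R ->
  entanglement_breaking L.
Proof.
(* Composing coefficients (p, b, c) with (1, 1, 0) gives (d p + p + b + c, b, c), which determines
   p. *)
move=> LE abc ab ac; pose p := (a - b - c) / (d%:R + 1).
have d1_gt0 : 0 < d%:R + 1 :> C by rewrite ltr_wpDl ?ler0n.
have d1_n0 := lt0r_neq0 d1_gt0.
have p0 : 0 <= p by rewrite divr_ge0 // ltW.
have pb : 0 <= p + b.
  have -> : p + b = (a + b * d%:R - c) / (d%:R + 1) by rewrite /p; field.
  by rewrite divr_ge0 // ltW.
have pc : 0 <= p + c.
  have -> : p + c = (a - b + c * d%:R) / (d%:R + 1) by rewrite /p; field.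
  by rewrite divr_ge0 // ltW.
pose x (t : {ffun 'I_d -> 'I_4} + 'I_d) :=
  match t with inl f => phase C f | inr i => basis C i end.
pose w (t : {ffun 'I_d -> 'I_4} + 'I_d) : C :=
  match t with inl f => (4 ^ d)%:R^-1 | inr i => 1 end.
apply: (@separable_measure _ _ _ L x
  (fun t => w t *: brauer k p b c (x t *m (x t)^t*))).
  move=> Z; have -> : L Z = brauer k p b c ((\tr Z)%:M + Z).
    have -> : (\tr Z)%:M + Z = brauer false 1 1 0 Z.
      by rewrite /brauer_map /= mul1r scale1r scale0r addr0.
    rewrite brauer_comp // addbF LE; congr brauer_map; rewrite /p; by field.
  rewrite trace_id_design linearD !linear_sum big_sumType /=.
  congr (_ + _); apply: eq_bigr => t _; rewrite !linearZ /= ?scale1r //.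
move=> t; apply: psdmxP => v; rewrite -scalemxAl dotZr mulr_ge0 //.
  by case: t => * /=; rewrite ?invr_ge0 ?ler0n.
by apply: psdmx_dot; apply: psd_brauer_outer.
Qed.

(** The second triple is tested with its last two entries exchanged, which is the co-CP
    condition. *)
Lemma decomposable_brauer (L : {linear 'M[C]_d -> 'M[C]_d}) k (a b c p q r p' q' r' : C) :
  (forall Z, L Z = brauer k a b c Z) ->
  cp_coef d p q r -> cp_coef d p' r' q' ->
  a = p + p' -> b = q + q' -> c = r + r' -> decomposable L.
Proof.
move=> + H H' aE bE cE; rewrite {}aE {}bE {}cE => LE.
exists (brauer k p q r), (brauer k p' q' r'); split.
- exact/(CP_brauer d_ge4 d_even).
- exact/(coCP_brauer d_ge4 d_even).
move=> Z; rewrite LE /= /brauer_map -linearD; congr twist.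
by apply/matrixP => i j; rewrite !mxE; case: (i == j); rewrite ?mulr1n ?mulr0n; ring.
Qed.

Lemma PPT_cp_coef (L : {linear 'M[C]_d -> 'M[C]_d}) k (a b c : C) :
  (forall Z, L Z = brauer k a b c Z) -> PPT L -> cp_coef d a b c /\ cp_coef d a c b.
Proof.
move=> LE /PPTP[cp cocp]; split.
  apply/(CP_brauer d_ge4 d_even k a b c).
  exact/(@eq_CP C d L (brauer k a b c) LE).
apply/(coCP_brauer d_ge4 d_even k a b c).
rewrite /coCP; apply/(@eq_CP C d (trmx \o L)) => // Z /=.
by rewrite LE.
Qed.

Lemma cp_coef_real (a b c : C) : cp_coef d a b c -> cp_coef d a c b ->
  [/\ a \is Num.real, b \is Num.real & c \is Num.real].
Proof.
move=> H H'.
have /ger0_real ac1 := cp_coef_sym d_ge4 d_even H.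
have /ger0_real ac2 := cp_coef_skew d_ge4 d_even H.
have /ger0_real ab1 := cp_coef_sym d_ge4 d_even H'.
have ra : a \is Num.real.
  have -> : a = ((a + c) + (a - c)) / 2 by field.
  apply: realM; first exact: realD.
  by apply/ger0_real; rewrite invr_ge0 ler0n.
split=> //.
- by rewrite -[b](addKr a) addrC rpredB.
- by rewrite -[c](addKr a) addrC rpredB.
Qed.

(* Put s = b2 + c2, t = trace map, I = identity.  The positive map decomposes as
   a1 (t - I - sigma) + (a1 + b1) I + (a1 + c1) sigma, and (t - I - sigma) composed
   with the second map is ((d - 2) a2 + s) t - s (I + sigma); when s >= 0 one uses
   that t - sigma is CP and t - I is co-CP. *)
Lemma decomposable_cone (L : {linear 'M[C]_d -> 'M[C]_d}) k (a1 b1 c1 a2 b2 c2 : C) :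
  (forall Z, L Z = brauer k (d%:R * a1 * a2 + a1 * (b2 + c2) + (b1 + c1) * a2)
    (b1 * b2 + c1 * c2) (b1 * c2 + c1 * b2) Z) ->
  [/\ 0 <= a1, 0 <= a1 + b1 & 0 <= a1 + c1] ->
  cp_coef d a2 b2 c2 -> cp_coef d a2 c2 b2 ->
  0 <= (d%:R - 2) * a2 + (b2 + c2) -> 0 <= (d%:R - 2) * a2 - (b2 + c2) ->
  0 <= b2 + c2 \/ 0 <= - (b2 + c2) -> decomposable L.
Proof.
move=> LE [a1_ge0 ab1 ac1] cp2 cocp2 sp sm.
have base := cp_coefD (cp_coefZ ab1 cp2) (cp_coefZ ac1 cocp2).
case=> s0.
(* The trace coefficient (d - 2) a2 + s splits as ((d - 2) a2 - s) + s + s: one s goes to t - sigma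
   and the other, in the co-CP part, to t - I. *)
- have H := cp_coefD base (cp_coefZ a1_ge0 (cp_coefD
    (cp_coefZ s0 (@cp_coef_trace_sub_sigma C d)) (cp_coefZ sm (@cp_coef_trace C d)))).
  have H' := cp_coefZ a1_ge0 (cp_coefZ s0 (@cp_coef_trace_sub_sigma C d)).
  by apply: (decomposable_brauer LE H H'); ring.
(* Here -s is nonnegative, so -s I is CP and -s sigma is co-CP, while the whole trace term is CP. *)
- have H := cp_coefD base (cp_coefZ a1_ge0 (cp_coefD
    (cp_coefZ s0 (@cp_coef_id C d)) (cp_coefZ sp (@cp_coef_trace C d)))).
  have H' := cp_coefZ a1_ge0 (cp_coefZ s0 (@cp_coef_id C d)).
  by apply: (decomposable_brauer LE H H'); ring.
Qed.

Lemma brauer_commute k k' (a b c a' b' c' : C) Z :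
  brauer k a b c (brauer k' a' b' c' Z) = brauer k' a' b' c' (brauer k a b c Z).
Proof.
rewrite !brauer_comp // addbC; congr brauer_map; ring.
Qed.

End Composition.

(** The three CP tests applied to (x, y, z) and to (x, z, y), over a real field where linear and
    nonlinear arithmetic apply; n stands for d. *)
Definition ppt_coef (R : realFieldType) (n x y z : R) : Prop :=
  [/\ 0 <= x + z, 0 <= x - z, 0 <= x + y, 0 <= x - y
    & 0 <= x + y * n - z /\ 0 <= x - y + z * n].

(** * Inequalities between coefficients *)

Section RealCoefficients.
Variables (R : realFieldType) (n : R).

(** Adding n times the first of the last two conditions to the second eliminates z and leaves a
    factor n + 1. *)
Lemma ppt_coef_lower x y z : 4 <= n -> ppt_coef n x y z -> 0 <= x + y * (n - 1).
Proof.
move=> n_ge4 [_ _ _ _ [H1 H2]].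
have n1 : 0 < n + 1 by lra.
rewrite -(pmulr_rge0 _ n1).
have -> : (n + 1) * (x + y * (n - 1)) = n * (x + y * n - z) + (x - y + z * n) by ring.
by rewrite addr_ge0 // mulr_ge0 //; lra.
Qed.

Lemma ppt_coef_swap x y z : ppt_coef n x y z -> ppt_coef n x z y.
Proof. by case=> *; split; [..| split]; lra. Qed.

(** After multiplication by n - 1, the expression is a sum of products of lower bounds for the first
    map with conditions on the second, plus a nonnegative multiple of x x'. *)
Lemma ppt_coef_comp_omega x y z x' y' z' : 4 <= n ->
  ppt_coef n x y z -> ppt_coef n x' y' z' ->
  0 <= (n * x * x' + x * (y' + z') + (y + z) * x') + (y * y' + z * z') * n
       - (y * z' + z * y').
Proof.
move=> n_ge4 H H'; have Y := ppt_coef_lower n_ge4 H.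
have Z := ppt_coef_lower n_ge4 (ppt_coef_swap H).
case: H => xz1 xz2 _ _ _; case: H' => xz1' xz2' _ _ [u v].
have n1 : 0 < n - 1 by lra.
rewrite -(pmulr_rge0 _ n1).
have -> : (n - 1) * ((n * x * x' + x * (y' + z') + (y + z) * x') + (y * y' + z * z') * n
       - (y * z' + z * y')) =
  (x + y * (n - 1)) * (x' + y' * n - z') + (x + z * (n - 1)) * (x' - y' + z' * n)
   + x * (x' * ((n - 1) * n - 2)) by ring.
have ? : 0 <= x by lra.
have ? : 0 <= x' by lra.
have ? : 0 <= (n - 1) * n - 2 by nra.
by rewrite !addr_ge0 ?mulr_ge0.
Qed.

(** The expression equals (n + 1) x x' - t t' with t = x - (y + z) and t' likewise, and the bounds
    on y and z give |t| <= 2 x and |t'| <= 2 x'. *)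
Lemma ppt_coef_comp_sum x y z x' y' z' : 4 <= n ->
  ppt_coef n x y z -> ppt_coef n x' y' z' ->
  0 <= (n * x * x' + x * (y' + z') + (y + z) * x') - (y * y' + z * z')
       - (y * z' + z * y').
Proof.
move=> n_ge4 H H'.
have Y := ppt_coef_lower n_ge4 H; have Z := ppt_coef_lower n_ge4 (ppt_coef_swap H).
have Y' := ppt_coef_lower n_ge4 H'; have Z' := ppt_coef_lower n_ge4 (ppt_coef_swap H').
case: H => xz1 xz2 xy1 xy2 _; case: H' => xz1' xz2' xy1' xy2' _.
have x0 : 0 <= x by lra.
have x0' : 0 <= x' by lra.
(* For negative s, n - 1 >= 3 weakens the lower bound to a linear one independent of n. *)
have bound (s t : R) : 0 <= t -> 0 <= t + s * (n - 1) -> - t <= 3 * s by nra.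
have B1 := bound _ _ x0 Y; have B2 := bound _ _ x0 Z.
have B1' := bound _ _ x0' Y'; have B2' := bound _ _ x0' Z'.
pose t := x - (y + z); pose t' := x' - (y' + z').
have -> : (n * x * x' + x * (y' + z') + (y + z) * x') - (y * y' + z * z')
       - (y * z' + z * y') = (n - 4) * (x * x') + (5 * (x * x') - t * t').
  by rewrite /t /t'; ring.
have T1 : t <= 2 * x by rewrite /t; lra.
have T2 : - (2 * x) <= t by rewrite /t; lra.
have T1' : t' <= 2 * x' by rewrite /t'; lra.
have T2' : - (2 * x') <= t' by rewrite /t'; lra.
apply: addr_ge0; first by rewrite !mulr_ge0 //; lra.
by clearbody t t'; nra.
Qed.

End RealCoefficients.

(** * Passage from complex to real coefficients *)

Section Transfer.
Variables (R : realType) (d : nat).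
Hypotheses (d_ge4 : (4 <= d)%N) (d_even : ~~ odd d).
Local Notation brauer := (@brauer_map R[i] d).

Lemma ge0_realc (t : R[i]) (u : R) : t = u%:C%C -> (0 <= t) = (0 <= u).
Proof. by move=> ->; rewrite -(rmorph0 (real_complex R)) lecR. Qed.

Lemma PPT_brauer k (a b c : R[i]) (L : {linear 'M[R[i]]_d -> 'M[R[i]]_d}) :
  (forall Z, L Z = brauer k a b c Z) -> PPT L ->
  exists x y z : R, [/\ ppt_coef d%:R x y z, a = x%:C, b = y%:C & c = z%:C]%C.
Proof.
move=> LE /(PPT_cp_coef d_ge4 d_even LE)[H H'].
have ac1 := cp_coef_sym d_ge4 d_even H; have ac2 := cp_coef_skew d_ge4 d_even H.
have ab1 := cp_coef_sym d_ge4 d_even H'; have ab2 := cp_coef_skew d_ge4 d_even H'.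
have ab3 := cp_coef_omega d_ge4 d_even H; have ac3 := cp_coef_omega d_ge4 d_even H'.
have [ra rb rc] := cp_coef_real d_ge4 d_even H H'.
exists (complex.Re a), (complex.Re b), (complex.Re c).
have Ea := RRe_real ra; have Eb := RRe_real rb; have Ec := RRe_real rc.
split=> //; move: (complex.Re a) (complex.Re b) (complex.Re c) Ea Eb Ec.
move=> x y z xE yE zE; move: ac1 ac2 ab1 ab2 ab3 ac3; rewrite -xE -yE -zE.
rewrite (@ge0_realc _ (x + z)); last by rewrite rmorphD.
rewrite (@ge0_realc _ (x - z)); last by rewrite rmorphB.
rewrite (@ge0_realc _ (x + y)); last by rewrite rmorphD.
rewrite (@ge0_realc _ (x - y)); last by rewrite rmorphB.
rewrite (@ge0_realc _ (x + y * d%:R - z)); last first.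
  by rewrite rmorphB rmorphD rmorphM rmorph_nat.
rewrite (@ge0_realc _ (x + z * d%:R - y)); last first.
  by rewrite rmorphB rmorphD rmorphM rmorph_nat.
move=> h1 h2 h3 h4 h5 h6; split=> //; split=> //.
by rewrite addrAC.
Qed.

Lemma covariant_cases (L : {linear 'M[R[i]]_d -> 'M[R[i]]_d}) :
  covariantSS L \/ covariantSSbar L ->
  exists k a b c, forall Z, L Z = brauer k a b c Z.
Proof.
case=> [/(covariantSS_brauer d_ge4 d_even)|/(covariantSSbar_brauer d_ge4 d_even)] => H.
  by exists false.
by exists true.
Qed.

(** L is given only through the coefficients of the composite, so that one statement serves both
    orders of composition. *)
Lemma decomposable_positive_PPT (L L1 L2 : {linear 'M[R[i]]_d -> 'M[R[i]]_d})
    k k1 k2 (a1 b1 c1 a2 b2 c2 : R[i]) :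
  (forall Z, L1 Z = brauer k1 a1 b1 c1 Z) -> positive_map L1 ->
  (forall Z, L2 Z = brauer k2 a2 b2 c2 Z) -> PPT L2 ->
  (forall Z, L Z = brauer k (d%:R * a1 * a2 + a1 * (b2 + c2) + (b1 + c1) * a2)
    (b1 * b2 + c1 * c2) (b1 * c2 + c1 * b2) Z) -> decomposable L.
Proof.
move=> L1E pos1 L2E ppt2 LE.
have H1 : [/\ 0 <= a1, 0 <= a1 + b1 & 0 <= a1 + c1].
  apply: (@positive_brauer _ _ d_ge4 d_even k1) => Z pZ.
  by have := pos1 Z pZ; rewrite L1E.
have [x [y [z [[xz1 xz2 xy1 xy2 _] xE yE zE]]]] := PPT_brauer L2E ppt2.
have [cp2 cocp2] := PPT_cp_coef d_ge4 d_even L2E ppt2.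
have d4 : 4 <= d%:R :> R by rewrite ler_nat.
apply: (decomposable_cone d_ge4 d_even LE H1 cp2 cocp2).
(* Both bounds follow from |y|, |z| <= x and d - 2 >= 2. *)
- rewrite (@ge0_realc _ ((d%:R - 2) * x + (y + z))); first by nra.
  by rewrite xE yE zE !(rmorphD, rmorphM, rmorphN, rmorph_nat).
- rewrite (@ge0_realc _ ((d%:R - 2) * x - (y + z))); first by nra.
  by rewrite xE yE zE !(rmorphD, rmorphM, rmorphN, rmorph_nat).
- have sE : b2 + c2 = (y + z)%:C%C by rewrite yE zE rmorphD.
  have nsE : - (b2 + c2) = (- (y + z))%:C%C by rewrite rmorphN sE.
  rewrite (ge0_realc sE) (ge0_realc nsE).
  by rewrite oppr_ge0; apply/orP; exact: le_total.
Qed.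

End Transfer.

Theorem theorem5p3 (R : realType) (d : nat)
    (d_ge4 : (4 <= d)%N) (d_even : ~~ odd d)
    (L1 L2 : {linear 'M[R[i]]_d -> 'M[R[i]]_d})
    (hL1 : herm_preserving L1) (hL2 : herm_preserving L2) :
  (PPT L1 -> (covariantSS L1 \/ covariantSSbar L1) ->
   PPT L2 -> (covariantSS L2 \/ covariantSSbar L2) ->
   entanglement_breaking (L1 \o L2))
  /\
  (positive_map L1 -> (covariantSS L1 \/ covariantSSbar L1) ->
   PPT L2 -> (covariantSS L2 \/ covariantSSbar L2) ->
   decomposable (L1 \o L2) /\ decomposable (L2 \o L1)).
Proof.
split=> [ppt1|pos1] /(covariant_cases d_ge4 d_even)[k1 [a1 [b1 [c1 L1E]]]] ppt2
  /(covariant_cases d_ge4 d_even)[k2 [a2 [b2 [c2 L2E]]]]; last first.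
  have comp := brauer_comp d_ge4 d_even k1 k2 a1 b1 c1 a2 b2 c2.
  split; apply: (decomposable_positive_PPT d_ge4 d_even L1E pos1 L2E ppt2) => Z /=.
    by rewrite L1E L2E; exact: comp.
  by rewrite L1E L2E brauer_commute //; exact: comp.
have d4 : 4 <= d%:R :> R by rewrite ler_nat.
have [x1 [y1 [z1 [P1 xE1 yE1 zE1]]]] := PPT_brauer d_ge4 d_even L1E ppt1.
have [x2 [y2 [z2 [P2 xE2 yE2 zE2]]]] := PPT_brauer d_ge4 d_even L2E ppt2.
have S := ppt_coef_comp_sum d4 P1 P2.
have T := ppt_coef_comp_omega d4 P1 P2.
(* Exchanging y2 and z2 exchanges the last two coefficients of the composite, so this gives the
   remaining inequality. *)
have U := ppt_coef_comp_omega d4 P1 (ppt_coef_swap P2).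
rewrite [z2 + y2]addrC addrAC in U.
apply: (@entanglement_breaking_brauer _ _ d_ge4 d_even _ (k1 (+) k2) _ _ _).
- by move=> Z /=; rewrite L1E L2E; exact: brauer_comp.
- move: S; rewrite -(@ge0_realc _ _ _ erefl); congr (_ <= _).
  by rewrite xE1 yE1 zE1 xE2 yE2 zE2 !(rmorphD, rmorphM, rmorphN, rmorph_nat).
- move: T; rewrite -(@ge0_realc _ _ _ erefl); congr (_ <= _).
  by rewrite xE1 yE1 zE1 xE2 yE2 zE2 !(rmorphD, rmorphM, rmorphN, rmorph_nat).
- move: U; rewrite -(@ge0_realc _ _ _ erefl); congr (_ <= _).
  by rewrite xE1 yE1 zE1 xE2 yE2 zE2 !(rmorphD, rmorphM, rmorphN, rmorph_nat).
Qed.
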